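(* Let $n\ge 1$ and let $u_1,u_2,\ldots,u_n$ be real $C^2$ functions on $\mathbb{H}^n$. Then $$\triangle u_1\wedge\ldots\wedge\triangle u_n=n!\,\det(u_1,u_2,\ldots,u_n)\,\Omega_{2n},$$ where $\triangle$ is the Baston operator and $\det(u_1,\ldots,u_n)$ is the mixed quaternionic Monge-Ampère operator.
   Context: Coordinates: for $q=(q_0,\ldots,q_{n-1})^t\in\mathbb{H}^n$ write $q_l=x_{4l}+x_{4l+1}\mathbf{i}+x_{4l+2}\mathbf{j}+x_{4l+3}\mathbf{k}$, $l=0,\ldots,n-1$. Set $$\frac{\partial}{\partial\overline{q_l}}=\partial_{x_{4l}}+\mathbf{i}\partial_{x_{4l+1}}+\mathbf{j}\partial_{x_{4l+2}}+\mathbf{k}\partial_{x_{4l+3}},\qquad \frac{\partial}{\partial q_l}=\partial_{x_{4l}}-\mathbf{i}\partial_{x_{4l+1}}-\mathbf{j}\partial_{x_{4l+2}}-\mathbf{k}\partial_{x_{4l+3}} .$$ For a real $C^2$ function $u$, the quaternionic Hessian at $q$ is the $n\times n$ hyperhermitian matrix with $(l,k)$ entry $\frac{\partial^2u}{\partial\overline{q_l}\,\partial q_k}(q)$, the operators being multiplied in this order, i.e. $\sum_{\beta,\gamma=0}^3 e_\beta\overline{e_\gamma}\,\partial_{x_{4l+\beta}}\partial_{x_{4k+\gamma}}u$ with $(e_0,e_1,e_2,e_3)=(1,\mathbf{i},\mathbf{j},\mathbf{k})$. (Hyperhermitian: $\mathcal{M}_{jk}=\overline{\mathcal{M}_{kj}}$.)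 Moore determinant: for a hyperhermitian $\mathcal{M}\in M_{\mathbb{H}}(n,n)$ there is a quaternionic unitary $\mathcal{E}$ ($\mathcal{E}^*\mathcal{E}=\mathcal{E}\mathcal{E}^*=I_n$, $\mathcal{E}^*=\overline{\mathcal{E}}^t$) with $\mathcal{E}^*\mathcal{M}\mathcal{E}=\mathrm{diag}(\nu_0,\ldots,\nu_{n-1})$, $\nu_l\in\mathbb{R}$, and $\det\mathcal{M}=\nu_0\cdots\nu_{n-1}$ (independent of choices; a homogeneous polynomial of degree $n$ on the real vector space of hyperhermitian matrices). For hyperhermitian $\mathcal{M}_1,\ldots,\mathcal{M}_n$, the mixed discriminant $\det(\mathcal{M}_1,\ldots,\mathcal{M}_n)$ is the coefficient of $\lambda_1\cdots\lambda_n$ in $\det(\lambda_1\mathcal{M}_1+\cdots+\lambda_n\mathcal{M}_n)$ ($\lambda_j$ real variables), divided by $n!$. The mixed quaternionic Monge-Ampère operator is the function $$\det(u_1,\ldots,u_n)(q)=\det\left(\left(\frac{\partial^2u_1}{\partial\overline{q_l}\partial q_k}(q)\right),\ldots,\left(\frac{\partial^2u_n}{\partial\overline{q_l}\partial q_k}(q)\right)\right).$$ Baston operator: for $l=0,\ldots,n-1$ define complex first-order operators $$\nabla_{l0'}=\partial_{x_{4l}}+\mathbf{i}\partial_{x_{4l+1}},\quad \nabla_{l1'}=-\partial_{x_{4l+2}}-\mathbf{i}\partial_{x_{4l+3}},\quad \nabla_{(n+l)0'}=\partial_{x_{4l+2}}-\mathbf{i}\partial_{x_{4l+3}},\quad \nabla_{(n+l)1'}=\partial_{x_{4l}}-\mathbf{i}\partial_{x_{4l+1}}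 .$$ With a fixed basis $\{\omega^0,\ldots,\omega^{2n-1}\}$ of $\mathbb{C}^{2n}$, $$\triangle u=\sum_{A,B=0}^{2n-1}\triangle_{AB}u\;\omega^A\wedge\omega^B,\qquad \triangle_{AB}u=\tfrac12\left(\nabla_{A0'}\nabla_{B1'}u-\nabla_{B0'}\nabla_{A1'}u\right),$$ a $\wedge^2\mathbb{C}^{2n}$-valued function on $\mathbb{H}^n$; wedge products are taken pointwise, and $\Omega_{2n}=\omega^0\wedge\omega^{n}\wedge\omega^1\wedge\omega^{n+1}\wedge\cdots\wedge\omega^{n-1}\wedge\omega^{2n-1}$. *)

(* Defs.v *)
From HB Require Import structures.
From mathcomp Require Import all_boot all_order all_algebra.
From mathcomp Require Import ring complex mpoly.
From mathcomp Require Import classical_sets reals topology normedtype derive.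

Set Implicit Arguments.
Unset Strict Implicit.
Unset Printing Implicit Defensive.

Import Order.TTheory GRing.Theory Num.Theory.
Import numFieldNormedType.Exports.

Local Open Scope ring_scope.

Record quaternion (R : Type) : Type :=
  Quaternion { qre : R; qi : R; qj : R; qk : R }.

Section QuaternionRing.
Variable R : comNzRingType.
Implicit Types x y z : quaternion R.

Definition quaternion_to_tuple x := (qre x, qi x, qj x, qk x).
Definition quaternion_of_tuple (t : R * R * R * R) :=
  let: (a, b, c, d) := t in Quaternion a b c d.

Lemma quaternion_to_tupleK : cancel quaternion_to_tuple quaternion_of_tuple.
Proof. by case. Qed.

HB.instance Definition _ :=
  Choice.copy (quaternion R) (can_type quaternion_to_tupleK).

Definition addq x y :=
  Quaternion (qre x + qre y) (qi x + qi y) (qj x + qj y) (qk x + qk y).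
Definition oppq x := Quaternion (- qre x) (- qi x) (- qj x) (- qk x).
Definition zeroq : quaternion R := Quaternion 0 0 0 0.
Definition oneq : quaternion R := Quaternion 1 0 0 0.
Definition mulq x y :=
  Quaternion
    (qre x * qre y - qi x * qi y - qj x * qj y - qk x * qk y)
    (qre x * qi y + qi x * qre y + qj x * qk y - qk x * qj y)
    (qre x * qj y - qi x * qk y + qj x * qre y + qk x * qi y)
    (qre x * qk y + qi x * qj y - qj x * qi y + qk x * qre y).

Fact addqA : associative addq.
Proof. by move=> x y z; rewrite /addq /= !addrA. Qed.
Fact addqC : commutative addq.
Proof. by move=> x y; congr Quaternion; apply: addrC. Qed.
Fact add0q : left_id zeroq addq.
Proof. by case=> a b c d; rewrite /addq /= !add0r. Qed.
Fact addNq : left_inverse zeroq oppq addq.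
Proof. by case=> a b c d; rewrite /addq /= !addNr. Qed.

HB.instance Definition _ :=
  GRing.isZmodule.Build (quaternion R) addqA addqC add0q addNq.

Fact mulqA : associative mulq.
Proof. by move=> x y z; congr Quaternion => /=; ring. Qed.
Fact mul1q : left_id oneq mulq.
Proof. by case=> a b c d; congr Quaternion => /=; ring. Qed.
Fact mulq1 : right_id oneq mulq.
Proof. by case=> a b c d; congr Quaternion => /=; ring. Qed.
Fact mulqDl : left_distributive mulq addq.
Proof. by move=> x y z; congr Quaternion => /=; ring. Qed.
Fact mulqDr : right_distributive mulq addq.
Proof. by move=> x y z; congr Quaternion => /=; ring. Qed.
Fact oneq_neq0 : oneq != zeroq.
Proof. by apply/eqP => -[] /eqP; rewrite oner_eq0. Qed.

HB.instance Definition _ := GRing.Zmodule_isNzRing.Build (quaternion R)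
  mulqA mul1q mulq1 mulqDl mulqDr oneq_neq0.

Definition qconj x := Quaternion (qre x) (- qi x) (- qj x) (- qk x).

Definition qreal (a : R) : quaternion R := Quaternion a 0 0 0.

(* (e_0, e_1, e_2, e_3) = (1, i, j, k) *)
Definition qunit (b : 'I_4) : quaternion R :=
  Quaternion (b == 0 :> nat)%:R (b == 1 :> nat)%:R
             (b == 2 :> nat)%:R (b == 3 :> nat)%:R.

End QuaternionRing.

Section MooreDeterminant.
Variables (R : realType) (n : nat).
Implicit Types M E : 'M[quaternion R]_n.

Definition qadjoint M := (map_mx (@qconj R) M)^T.

Definition qunitary E := qadjoint E *m E = 1%:M /\ E *m qadjoint E = 1%:M.

(* The value does not depend on the diagonalization.  When M is not
   hyperhermitian there is none, and the value is the junk value 0. *)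
Definition moore_det M : R :=
  xget 0 [set d : R | exists E (nu : 'rV[R]_n),
    [/\ qunitary E,
        qadjoint E *m M *m E = diag_mx (map_mx (@qreal R) nu)
      & d = \prod_l nu 0 l]]%classic.

(* The polynomial p, which exists when the M i are hyperhermitian, is unique
   since R is infinite. *)
Definition mixed_discriminant (M : 'I_n -> 'M[quaternion R]_n) : R :=
  xget 0 [set c : R | exists p : {mpoly R[n]},
    (forall lambda : 'I_n -> R,
       p.@[lambda] = moore_det (\sum_i qreal (lambda i) *: M i)) /\
    c = p@_[multinom 1%N | i < n] / n`!%:R]%classic.

End MooreDeterminant.

(* H^n is identified with R^(4n): the coordinate x_(4l+b) of q is q l b. *)
Notation Hn R n := 'M[R]_(n, 4).

Section Derivatives.
Variables (R : realType) (n : nat).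

Definition partial (l : 'I_n) (b : 'I_4) (u : Hn R n -> R) : Hn R n -> R :=
  fun q => 'D_(delta_mx l b) u q.

Fixpoint Ck (k : nat) (u : Hn R n -> R) : Prop :=
  continuous u /\
  if k is k'.+1 then
    forall (l : 'I_n) (b : 'I_4),
      (forall q, derivable u q (delta_mx l b)) /\ Ck k' (partial l b u)
  else True.

Definition qpartial (l : 'I_n) (b : 'I_4) (f : Hn R n -> quaternion R)
    : Hn R n -> quaternion R :=
  fun q => Quaternion (partial l b (fun x => qre (f x)) q)
                      (partial l b (fun x => qi (f x)) q)
                      (partial l b (fun x => qj (f x)) q)
                      (partial l b (fun x => qk (f x)) q).

(* d / d \bar q_l and d / d q_l, acting from the left and without the usual
   normalizing factor *)
Definition dqbar (l : 'I_n) (f : Hn R n -> quaternion R)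
    : Hn R n -> quaternion R :=
  fun q => \sum_(b < 4) qunit R b * qpartial l b f q.

Definition dq (l : 'I_n) (f : Hn R n -> quaternion R)
    : Hn R n -> quaternion R :=
  fun q => \sum_(b < 4) qconj (qunit R b) * qpartial l b f q.

Definition qhessian (u : Hn R n -> R) (q : Hn R n) : 'M[quaternion R]_n :=
  \matrix_(l, k) dqbar l (dq k (fun x => qreal (u x))) q.

Definition mixed_MA (u : 'I_n -> Hn R n -> R) (q : Hn R n) : R :=
  mixed_discriminant (fun i => qhessian (u i) q).

Definition cpartial (l : 'I_n) (b : 'I_4) (f : Hn R n -> R[i])
    : Hn R n -> R[i] :=
  fun q => (partial l b (fun x => complex.Re (f x)) q
            +i* partial l b (fun x => complex.Im (f x)) q)%C.

(* nabla_(A0') and nabla_(A1'); through 'split', an index A of 'I_(n + n) is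
   either l or n + l with l of 'I_n. *)
Definition nabla0 (A : 'I_(n + n)) (f : Hn R n -> R[i]) : Hn R n -> R[i] :=
  match split A with
  | inl l => fun q => cpartial l (inord 0) f q + 'i%C * cpartial l (inord 1) f q
  | inr l => fun q => cpartial l (inord 2) f q - 'i%C * cpartial l (inord 3) f q
  end.

Definition nabla1 (A : 'I_(n + n)) (f : Hn R n -> R[i]) : Hn R n -> R[i] :=
  match split A with
  | inl l => fun q =>
      - cpartial l (inord 2) f q - 'i%C * cpartial l (inord 3) f q
  | inr l => fun q => cpartial l (inord 0) f q - 'i%C * cpartial l (inord 1) f q
  end.

Definition baston_coef (A B : 'I_(n + n)) (u : Hn R n -> R) (q : Hn R n)
    : R[i] :=
  let uC := fun x => (u x)%:C%C in
  2^-1 * (nabla0 A (nabla1 B uC) q - nabla0 B (nabla1 A uC) q).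

End Derivatives.

(* The exterior algebra of K^m: x S is the coordinate of x on the basis
   vector e_(s_1) /\ ... /\ e_(s_k), where s_1 < ... < s_k enumerate S and e
   is the canonical basis of K^m. *)
Notation exterior K m := {ffun {set 'I_m} -> K^o}.

Section Exterior.
Variables (K : comNzRingType) (m : nat).

(* e_S /\ e_T = wedge_sign S T *: e_(S :|: T) for disjoint S and T *)
Definition wedge_sign (S T : {set 'I_m}) : K :=
  (-1) ^+ #|[set p in finset.setX S T | (p.2 < p.1)%N]|.

Definition wedge (x y : exterior K m) : exterior K m :=
  [ffun U : {set 'I_m} =>
     \sum_(S in powerset U) wedge_sign S (U :\: S) * x S * y (U :\: S)].

Definition exterior1 : exterior K m :=
  [ffun U : {set 'I_m} => (U == finset.set0)%:R].

Definition exterior_vec (v : 'rV[K]_m) : exterior K m :=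
  [ffun U : {set 'I_m} => \sum_(i | U == [set i]%SET) v 0 i].

End Exterior.

Section Baston.
Variables (R : realType) (n : nat).
Variable omega : (n + n).-tuple 'rV[R[i]]_(n + n).

Definition basis_form (A : 'I_(n + n)) : exterior R[i] (n + n) :=
  exterior_vec (tnth omega A).

Definition baston (u : Hn R n -> R) (q : Hn R n) : exterior R[i] (n + n) :=
  \sum_A \sum_B baston_coef A B u q *: wedge (basis_form A) (basis_form B).

Definition Omega : exterior R[i] (n + n) :=
  \big[@wedge _ _ / exterior1 _ _]_(l < n)
    wedge (basis_form (lshift n l)) (basis_form (rshift n l)).

End Baston.

(* Main.v *)
(** Write a quaternionic matrix as P + Q j with complex P and Q. Up to the factor
    1/2, the coefficient matrix of the Baston form of u is the skew matrix
    N(M) = [[Q, P], [- conj P, conj Q]] of the Hessian M of u, and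
    N(E M E^* ) = X N(M) X^T, where X is the complex matrix of E. The Hessian is
    hyperhermitian by the symmetry of second derivatives, so M = E diag(nu) E^*
    with E unitary. In the frame moved by X the form of M is
    2 sum_l nu_l w'_l /\ w'_(n+l), whose n-th power is
    2^n n! (prod_l nu_l) times the volume of the moved frame, and this volume is
    the one of the initial frame: compare the two expressions of the n-th power
    of the form of the identity matrix, which E does not change. Hence the n-th
    power of the form of M is 2^n n! det(M) Omega. As 2-forms commute, the theorem
    follows by comparing the coefficients of lambda_1 ... lambda_n in this
    identity for M = sum_i lambda_i M_i. *)

Require Import Defs.
From HB Require Import structures.
From mathcomp Require Import all_boot all_order all_algebra.
From mathcomp Require Import spectral complex ring mpoly.
From mathcomp Require Import classical_sets reals topology normedtype derive.
From mathcomp Require Import fintype finset.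

Set Implicit Arguments.
Unset Strict Implicit.
Unset Printing Implicit Defensive.

Import Order.TTheory GRing.Theory Num.Theory.

Local Open Scope ring_scope.

(** * Products and powers of sums of commuting elements *)

Section CommutingFamilies.
Variable A : pzRingType.

Lemma perm_big_comm (I : eqType) (b : I -> A) (s t : seq I) :
  (forall i j, GRing.comm (b i) (b j)) -> perm_eq s t ->
  \prod_(i <- s) b i = \prod_(i <- t) b i.
Proof.
move=> bC; pose P r := \prod_(i <- s) b i = \prod_(i <- r) b i.
(* Every permutation is reached by exchanges of two neighbouring blocks, and commuting factors allow
   each of them. *)
move=> st; apply: (@catCA_perm_ind _ P _ s t st) => // s1 s2 s3; rewrite /P => ->.
rewrite !big_cat /= !mulrA; congr (_ * _).
by apply: commr_prod => i _; apply/commr_sym/commr_prod => j _; apply: bC.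
Qed.

Variable n : nat.

Lemma prod_comm_reindex (b : 'I_n -> A) (f : {ffun 'I_n -> 'I_n}) :
  (forall i j, GRing.comm (b i) (b j)) -> injectiveb f ->
  \prod_i b (f i) = \prod_i b i.
Proof.
move=> bC /injectiveP fI.
rewrite -(big_map f xpredT b); apply: perm_big_comm => //.
apply: uniq_perm; rewrite ?map_inj_uniq ?index_enum_uniq //.
move=> i; rewrite mem_index_enum; apply/mapP.
by exists (invF fI i); rewrite ?mem_index_enum ?f_invF.
Qed.

Lemma exp_sum_ffun (b : 'I_n -> A) :
  (\sum_i b i) ^+ n = \sum_(f : {ffun 'I_n -> 'I_n}) \prod_i b (f i).
Proof.
transitivity (\prod_(i < n) \sum_j b j); first by rewrite prodr_const card_ord.
by rewrite (bigA_distr_bigA (fun (_ : 'I_n) j => b j)).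
Qed.

Lemma card_injectiveb :
  #|[pred f : {ffun 'I_n -> 'I_n} | injectiveb f]| = n`!.
Proof. by have := card_inj_ffuns 'I_n 'I_n; rewrite card_ord ffactnn cardsE. Qed.

(** A repeated letter gives two equal factors, which commutation brings side by side. *)
Lemma prod_square0 (y : 'I_n -> A) (f : {ffun 'I_n -> 'I_n}) :
  (forall i j, GRing.comm (y i) (y j)) -> (forall i, y i * y i = 0) ->
  ~~ injectiveb f -> \prod_i y (f i) = 0.
Proof.
move=> yC y0 /injectivePn[i [j ij fij]].
have: perm_eq (index_enum 'I_n) (i :: j :: rem j (rem i (index_enum 'I_n))).
  apply: (perm_trans (perm_to_rem (mem_index_enum i))).
  rewrite perm_cons; apply: perm_to_rem.
  by rewrite mem_rem_uniq ?index_enum_uniq // inE eq_sym ij mem_index_enum.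
move/(perm_big_comm (b := fun i => y (f i)) (fun i j => yC _ _)) => ->.
by rewrite !big_cons fij mulrA y0 mul0r.
Qed.

Lemma exp_sum_square0 (y : 'I_n -> A) :
  (forall i j, GRing.comm (y i) (y j)) -> (forall i, y i * y i = 0) ->
  (\sum_i y i) ^+ n = (\prod_i y i) *+ n`!.
Proof.
move=> yC y0; rewrite exp_sum_ffun.
rewrite (bigID (fun f : {ffun 'I_n -> 'I_n} => injectiveb f)) /=.
rewrite [X in _ + X]big1 ?addr0 => [|f fI]; last exact: prod_square0.
under eq_bigr => f fI do rewrite prod_comm_reindex //.
by rewrite sumr_const card_injectiveb.
Qed.

End CommutingFamilies.

(** * Two-forms in an anticommuting frame and their n-th powers *)

Section TwoForms.
Variables (K : numFieldType) (A : algType K) (n : nat).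
Implicit Types (w : 'I_(n + n) -> A) (N : 'M[K]_(n + n)) (nu : 'rV[K]_n).

(** The case i = j is included; as 2 is invertible in K, it makes the squares vanish. *)
Definition anticommuting w := forall i j, w i * w j = - (w j * w i).

Definition form2 w N : A := \sum_i \sum_j N i j *: (w i * w j).

Definition frame_change w (X : 'M[K]_(n + n)) : 'I_(n + n) -> A :=
  fun j => \sum_i X i j *: w i.

Definition volume w : A := \prod_(l < n) (w (lshift n l) * w (rshift n l)).

Definition symplectic_mx nu : 'M[K]_(n + n) :=
  block_mx 0 (diag_mx nu) (- diag_mx nu) 0.

Lemma form2D w : {morph form2 w : N N' / N + N'}.
Proof.
move=> N N'; rewrite -big_split; apply: eq_bigr => i _.
by rewrite -big_split; apply: eq_bigr => j _; rewrite mxE scalerDl.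
Qed.

Lemma form2Z w a : {morph form2 w : N / a *: N >-> a *: N}.
Proof.
move=> N; rewrite scaler_sumr; apply: eq_bigr => i _.
by rewrite scaler_sumr; apply: eq_bigr => j _; rewrite mxE scalerA.
Qed.

Lemma form2_sum w I (r : seq I) (P : pred I) (N : I -> 'M[K]_(n + n)) :
  form2 w (\sum_(i <- r | P i) N i) = \sum_(i <- r | P i) form2 w (N i).
Proof.
apply: (big_morph _ (form2D w)); rewrite /form2 big1 // => i _.
by rewrite big1 // => j _; rewrite mxE scale0r.
Qed.

Lemma anticommuting_square0 w i : anticommuting w -> w i * w i = 0.
Proof.
move/(_ i i)/eqP; rewrite -addr_eq0 -mulr2n -scaler_nat scaler_eq0.
by rewrite pnatr_eq0 => /eqP.
Qed.

Lemma anticommuting_frame_change w X :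
  anticommuting w -> anticommuting (frame_change w X).
Proof.
move=> wA i j; rewrite !mulr_suml -sumrN.
under eq_bigr do rewrite mulr_sumr.
rewrite exchange_big; apply: eq_bigr => k _.
rewrite mulr_sumr -sumrN; apply: eq_bigr => l _.
by rewrite -!scalerAl -!scalerAr (wA l) !scalerA mulrC scalerN.
Qed.

(** By bilinearity, a congruence of the coefficient matrix is absorbed by the frame. *)
Lemma form2_frame_change w X N :
  form2 w (X *m N *m X^T) = form2 (frame_change w X) N.
Proof.
rewrite /form2 /frame_change.
transitivity (\sum_i \sum_j \sum_k \sum_l
   (X i k * N k l * X j l) *: (w i * w j)).
  apply: eq_bigr => i _; apply: eq_bigr => j _.
  rewrite exchange_big mxE scaler_suml; apply: eq_bigr => l _.
  by rewrite !mxE mulr_suml scaler_suml.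
under eq_bigr do rewrite exchange_big.
rewrite exchange_big; apply: eq_bigr => k _.
under eq_bigr do rewrite exchange_big.
rewrite exchange_big; apply: eq_bigr => l _.
rewrite mulr_suml scaler_sumr; apply: eq_bigr => i _.
rewrite mulr_sumr scaler_sumr; apply: eq_bigr => j _.
rewrite -scalerAl -scalerAr !scalerA; congr (_ *: _); ring.
Qed.

(** Moving one pair past another takes four transpositions, so the signs cancel. *)
Lemma anticommuting_pairs w i j k l :
  anticommuting w -> GRing.comm (w i * w j) (w k * w l).
Proof.
move=> wA; rewrite /GRing.comm -mulrA (mulrA (w j)) (wA j k) mulNr mulrN.
rewrite mulrA (mulrA (w i)) (wA i k) mulNr mulNr opprK -!mulrA; congr (_ * _).
by rewrite (wA j l) mulrN !mulrA (wA i l) mulNr opprK.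
Qed.

Lemma form2_comm w N N' : anticommuting w -> GRing.comm (form2 w N) (form2 w N').
Proof.
move=> wA; apply: commr_sum => i _; apply: commr_sum => j _.
apply/commr_sym; apply: commr_sum => k _; apply: commr_sum => l _.
rewrite /GRing.comm -!scalerAl -!scalerAr !scalerA mulrC -!scalerA.
by rewrite (anticommuting_pairs _ _ _ _ wA).
Qed.

(** The sign of the lower block cancels the sign of anticommutation, so both off-diagonal blocks
    contribute the same sum; hence the factor 2. *)
Lemma form2_symplectic w nu : anticommuting w ->
  form2 w (symplectic_mx nu) =
  2 *: \sum_l nu 0 l *: (w (lshift n l) * w (rshift n l)).
Proof.
move=> wA; rewrite /form2 big_split_ord /= scaler_nat mulr2n.
congr (_ + _); apply: eq_bigr => l _; rewrite big_split_ord /=.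
  rewrite [X in X + _]big1 => [|i _]; last by rewrite block_mxEul mxE scale0r.
  rewrite add0r (bigD1 l) //= big1 ?addr0 => [|i li].
    by rewrite block_mxEur mxE eqxx mulr1n.
  by rewrite block_mxEur mxE eq_sym (negbTE li) mulr0n scale0r.
rewrite [X in _ + X]big1 => [|i _]; last by rewrite block_mxEdr mxE scale0r.
rewrite addr0 (bigD1 l) //= big1 ?addr0 => [|i li].
  by rewrite block_mxEdl !mxE eqxx mulr1n wA scaleNr scalerN opprK.
by rewrite block_mxEdl !mxE eq_sym (negbTE li) mulr0n oppr0 scale0r.
Qed.

(** The terms [nu 0 l *: (w (lshift n l) * w (rshift n l))] commute and have square zero, so
    [exp_sum_square0] applies. *)
Lemma exp_form2_symplectic w nu : anticommuting w ->
  form2 w (symplectic_mx nu) ^+ n =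
  (2 ^+ n * n`!%:R * \prod_l nu 0 l) *: volume w.
Proof.
move=> wA; rewrite form2_symplectic // exprZn -!scalerA; congr (_ *: _).
rewrite exp_sum_square0 => [|i j|i].
- rewrite -scaler_nat; congr (_ *: _).
  by rewrite /volume; elim/big_rec3: _ => [|l y x z _ ->];
     rewrite ?scale1r // -scalerAl -scalerAr scalerA.
- by rewrite /GRing.comm -!scalerAl -!scalerAr !scalerA mulrC -!scalerA
             (anticommuting_pairs _ _ _ _ wA).
rewrite -scalerAl -scalerAr mulrA -(mulrA (w _)) (wA (rshift _ _)).
by rewrite mulrN mulNr !mulrA anticommuting_square0 // !mul0r oppr0 !scaler0.
Qed.

End TwoForms.

(** * The exterior algebra as an associative algebra *)

Section ExteriorAlgebra.
Variables (K : comNzRingType) (m : nat).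
Implicit Types (S T U V : {set 'I_m}) (x y z : exterior K m).

(** The inversions counted for a disjoint union are the disjoint union of those counted for its two
    parts. *)
Lemma wedge_signUl S T U : [disjoint S & T] ->
  wedge_sign K (S :|: T) U = wedge_sign K S U * wedge_sign K T U.
Proof.
move=> dST; rewrite /wedge_sign -exprD -cardsUI; congr (_ ^+ _).
rewrite [X in (_ = _ + X)%N](_ : _ = 0)%N ?addn0.
  by apply: eq_card => -[i j]; rewrite !inE; case: (i \in S); case: (i \in T);
     case: (j \in U); case: (j < i)%N.
apply: eq_card0 => -[i j]; rewrite !inE.
by have := disjointFr dST (x := i); case: (i \in S) => [->//|_]; rewrite ?andbF.
Qed.

Lemma wedge_signUr S T U : [disjoint T & U] ->
  wedge_sign K S (T :|: U) = wedge_sign K S T * wedge_sign K S U.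
Proof.
move=> dTU; rewrite /wedge_sign -exprD -cardsUI; congr (_ ^+ _).
rewrite [X in (_ = _ + X)%N](_ : _ = 0)%N ?addn0.
  by apply: eq_card => -[i j]; rewrite !inE; case: (i \in S); case: (j \in T);
     case: (j \in U); case: (j < i)%N.
apply: eq_card0 => -[i j]; rewrite !inE.
have := disjointFr dTU (x := j).
by case: (j \in T) => [->//|_]; rewrite ?andbF ?andFb ?andbF.
Qed.

Lemma wedge_sign0l T : wedge_sign K set0 T = 1.
Proof.
rewrite /wedge_sign (_ : #|_| = 0%N) //.
by apply: eq_card0 => -[i j]; rewrite !inE.
Qed.

Lemma wedge_sign0r S : wedge_sign K S set0 = 1.
Proof.
rewrite /wedge_sign (_ : #|_| = 0%N) //.
by apply: eq_card0 => -[i j]; rewrite !inE andbF.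
Qed.

(** Both sides sum over the splittings of U into three disjoint parts, and the signs agree because
    [wedge_sign] is multiplicative on disjoint unions in each argument. *)
Lemma wedgeA : associative (@wedge K m).
Proof.
move=> x y z; apply/ffunP => U; rewrite !ffunE.
transitivity (\sum_(S in powerset U) \sum_(T in powerset S)
    wedge_sign K S (U :\: S) * wedge_sign K T (S :\: T) *
    x T * y (S :\: T) * z (U :\: S)); last first.
  apply: eq_bigr => S _; rewrite ffunE mulr_sumr mulr_suml.
  by apply: eq_bigr => T _; rewrite !mulrA.
rewrite (exchange_big_dep (mem (powerset U))) /=; last first.
  by move=> S T; rewrite !powersetE => SU TS; apply: subset_trans TS SU.
apply: eq_bigr => T; rewrite powersetE => TU.
rewrite ffunE mulr_sumr.
(* With T fixed, S is the union of T and V, where V indexes the inner sum of the left-hand side. *)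
rewrite [RHS](reindex_onto (fun V => T :|: V) (fun S => S :\: T)) /=; last first.
  move=> S; rewrite !powersetE => /andP[SU TS].
  by rewrite setDE setUIr setUCr setIT; apply/setUidPr.
apply: eq_big => V.
  rewrite !powersetE subUset TU subsetUl andbT /= setDUl setDv set0U.
  by rewrite subsetD -setI_eq0 setIC setI_eq0 (sameP eqP setDidPl) disjoint_sym.
rewrite powersetE subsetD => /andP[VU VT].
have TVD : (T :|: V) :\: T = V.
  by rewrite setDUl setDv set0U; apply/setDidPl.
have UTV : U :\: (T :|: V) = (U :\: T) :\: V by rewrite setDDl.
have UTE : U :\: T = V :|: (U :\: T) :\: V.
  rewrite -[LHS](setID _ V) (setIidPr _) // subsetD VU; exact: VT.
rewrite TVD UTV [in LHS]UTE.
rewrite wedge_signUr 1?disjoint_sym ?disjoints_subset ?subsetDr //.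
rewrite wedge_signUl 1?disjoint_sym //.
rewrite -UTE; ring.
Qed.

Lemma wedge1x : left_id (exterior1 K m) (@wedge K m).
Proof.
move=> x; apply/ffunP => U; rewrite ffunE (bigD1 set0) /=; last first.
  by rewrite powersetE sub0set.
rewrite ffunE eqxx setD0 wedge_sign0l !mul1r big1 ?addr0 // => S /andP[_ S0].
by rewrite ffunE (negbTE S0) mulr0 mul0r.
Qed.

Lemma wedgex1 : right_id (exterior1 K m) (@wedge K m).
Proof.
move=> x; apply/ffunP => U; rewrite ffunE (bigD1 U) /=; last first.
  by rewrite powersetE subxx.
rewrite ffunE setDv eqxx wedge_sign0r mul1r mulr1 big1 ?addr0 //.
move=> S /andP[]; rewrite powersetE => SU neSU; rewrite ffunE setD_eq0.
by rewrite eqEsubset SU andTb in neSU; rewrite (negbTE neSU) mulr0.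
Qed.

Lemma wedgeDl : left_distributive (@wedge K m) +%R.
Proof.
move=> x y z; apply/ffunP => U; rewrite !ffunE -big_split /=.
by apply: eq_bigr => S _; rewrite ffunE mulrDr mulrDl.
Qed.

Lemma wedgeDr : right_distributive (@wedge K m) +%R.
Proof.
move=> x y z; apply/ffunP => U; rewrite !ffunE -big_split /=.
by apply: eq_bigr => S _; rewrite ffunE mulrDr.
Qed.

Lemma exterior1_neq0 : exterior1 K m != 0.
Proof.
apply/eqP => /ffunP/(_ set0); rewrite !ffunE eqxx.
by apply/eqP; rewrite oner_eq0.
Qed.

Lemma wedgeZl (a : K) x y : a *: wedge x y = wedge (a *: x) y.
Proof.
apply/ffunP => U; rewrite !ffunE scaler_sumr.
by apply: eq_bigr => S _; rewrite ffunE /GRing.scale /=; ring.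
Qed.

Lemma wedgeZr (a : K) x y : a *: wedge x y = wedge x (a *: y).
Proof.
apply/ffunP => U; rewrite !ffunE scaler_sumr.
by apply: eq_bigr => S _; rewrite ffunE /GRing.scale /=; ring.
Qed.

(** A type name of its own carries the algebra structure whose product is [wedge], so that ring
    powers and products apply to forms. *)
Definition exterior_alg : Type := exterior K m.

HB.instance Definition _ := GRing.Lmodule.on exterior_alg.
HB.instance Definition _ := GRing.Zmodule_isNzRing.Build exterior_alg
  wedgeA wedge1x wedgex1 wedgeDl wedgeDr exterior1_neq0.
HB.instance Definition _ :=
  GRing.Lmodule_isLalgebra.Build K exterior_alg wedgeZl.
HB.instance Definition _ := GRing.Lalgebra_isAlgebra.Build K exterior_alg wedgeZr.

Definition exterior_basis S : exterior_alg := [ffun U => (U == S)%:R].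

Lemma exterior_basisM S T :
  exterior_basis S * exterior_basis T =
  if [disjoint S & T] then wedge_sign K S T *: exterior_basis (S :|: T) else 0.
Proof.
apply/ffunP => U; rewrite ffunE.
have -> : \sum_(S' in powerset U) wedge_sign K S' (U :\: S') *
    exterior_basis S S' * exterior_basis T (U :\: S') =
    ((S \subset U) && (U :\: S == T))%:R * wedge_sign K S T.
  rewrite big_mkcond (bigD1 S) //= big1 ?addr0 => [|S' neS].
    rewrite powersetE !ffunE eqxx mulr1.
    case: (S \subset U) => /=; last by rewrite mul0r.
    by case: eqP => [->|_]; rewrite ?mulr1 ?mul1r ?mulr0 ?mul0r.
  by rewrite ffunE (negbTE neS) mulr0 mul0r if_same.
have -> : (S \subset U) && (U :\: S == T) = [disjoint S & T] && (U == S :|: T).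
  apply/andP/andP => [[SU /eqP<-]|[dST /eqP->]].
    split; first by rewrite disjoint_sym disjoints_subset subsetDr.
    by rewrite -{1}(setID U S) (setIidPr SU).
  rewrite subsetUl setDUl setDv set0U; split => //.
  by apply/eqP/setDidPl; rewrite disjoint_sym.
case: ifP => dST /=; last by rewrite mul0r ffunE.
by rewrite ffunE ffunE /GRing.scale /= mulrC.
Qed.

Lemma exterior_vecE (v : 'rV[K]_m) :
  exterior_vec v = \sum_i v 0 i *: exterior_basis [set i] :> exterior_alg.
Proof.
apply/ffunP => U; rewrite sum_ffunE ffunE big_mkcond; apply: eq_bigr => i _.
by rewrite !ffunE /GRing.scale /=; case: eqP; rewrite ?mulr1 ?mulr0.
Qed.

(** For distinct i and j exactly one of the two orders is an inversion; for i = j both products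
    vanish. *)
Lemma exterior_basis1_anticomm i j :
  exterior_basis [set i] * exterior_basis [set j] =
  - (exterior_basis [set j] * exterior_basis [set i]).
Proof.
rewrite !exterior_basisM !disjoints1 !inE eq_sym.
case: (altP (j =P i)) => [|ji] /=; first by rewrite oppr0.
rewrite setUC -scaleNr; congr (_ *: _).
have sgn1 (k l : 'I_m) : wedge_sign K [set k] [set l] = (-1) ^+ (l < k)%N.
  rewrite /wedge_sign; congr (_ ^+ _).
  rewrite (_ : [set p in _ | _] = [set p | (p == (k, l)) && (l < k)%N]).
    case: (l < k)%N.
      by apply: etrans (cards1 (k, l)); apply: eq_card => p; rewrite !inE andbT.
    by apply: eq_card0 => p; rewrite !inE andbF.
  apply/setP => -[a b]; rewrite !inE xpair_eqE.
  by case: eqP => //= ->; case: eqP => //= ->.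
rewrite !sgn1; have : (j != i :> nat) by [].
by case: (ltngtP i j) => //= _ _; rewrite ?expr0 ?expr1 ?opprK.
Qed.

Lemma exterior_vec_anticomm (v w : 'rV[K]_m) :
  (exterior_vec v : exterior_alg) * exterior_vec w =
  - ((exterior_vec w : exterior_alg) * exterior_vec v).
Proof.
rewrite !exterior_vecE !mulr_suml -sumrN.
under eq_bigr do rewrite mulr_sumr.
rewrite exchange_big; apply: eq_bigr => k _.
rewrite mulr_sumr -sumrN; apply: eq_bigr => l _.
by rewrite -!scalerAl -!scalerAr exterior_basis1_anticomm !scalerA mulrC scalerN.
Qed.

(** The exponent stays existential: the sign only has to be nonzero. *)
Lemma exterior_basis_prod (I : eqType) (r : seq I) (S : I -> {set 'I_m}) :
  {in r &, forall i j, i != j -> [disjoint S i & S j]} -> uniq r ->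
  exists e : nat, \prod_(i <- r) exterior_basis (S i) =
    (-1) ^+ e *: exterior_basis (\bigcup_(i <- r) S i)%SET.
Proof.
elim: r => [|i r IHr] dS /=.
  exists 0%N; rewrite !big_nil expr0 scale1r.
  by apply/ffunP => U; rewrite !ffunE.
move=> /andP[ir ur]; have [|//|e Er] := IHr.
  by move=> j k jr kr; apply: dS; rewrite inE ?jr ?kr orbT.
rewrite !big_cons Er -scalerAr exterior_basisM ifT.
  by eexists; rewrite scalerA -exprD.
elim: r ir dS {IHr ur Er} => [|j r IHr] ir dS.
  by rewrite big_nil -setI_eq0 setI0.
rewrite big_cons; move: ir; rewrite inE negb_or => /andP[ij ir].
have dij : [disjoint S i & S j] by apply: dS; rewrite ?inE ?eqxx ?orbT.
have : [disjoint S i & (\bigcup_(i <- r) S i)%SET].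
  apply: IHr => // k l kr lr; apply: dS; move: kr lr.
    by rewrite !inE => /orP[->//|->]; rewrite !orbT.
  by rewrite !inE => _ /orP[->//|->]; rewrite !orbT.
by move: dij; rewrite -!setI_eq0 setIUr setU_eq0 => -> ->.
Qed.

End ExteriorAlgebra.

(** The volume of the canonical frame is thus nonzero in the top coordinate, by which
    [exists_moore_poly] divides. *)
Lemma volume_exterior_basis (K : numFieldType) n :
  exists e : nat, volume (fun i : 'I_(n + n) => exterior_basis K [set i]) =
    (-1) ^+ e *: exterior_basis K setT.
Proof.
rewrite /volume.
have pair (l : 'I_n) :
    exterior_basis K [set lshift n l] * exterior_basis K [set rshift n l]
   = exterior_basis K [set lshift n l; rshift n l].
  rewrite exterior_basisM disjoints1 inE eq_lrshift /=.
  rewrite /wedge_sign (_ : [set p in _ | _] = set0).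
    by rewrite cards0 expr0 scale1r.
  apply/setP => -[a b]; rewrite !inE.
  case: eqP => //= ->; case: eqP => //= ->.
  by rewrite ltnNge (leq_trans (ltnW (ltn_ord l))) ?leq_addr.
under eq_bigr do rewrite pair.
have [||e ->] := @exterior_basis_prod K (n + n) 'I_n (index_enum 'I_n)
  (fun l => [set lshift n l; rshift n l]).
- move=> i j _ _ ij; rewrite -setI_eq0; apply/eqP/setP => k; rewrite !inE.
  apply/negP => /andP[/orP[]/eqP-> /orP[]].
  + by rewrite (inj_eq (@lshift_inj _ _)) (negbTE ij).
  + by rewrite eq_lrshift.
  + by rewrite eq_rlshift.
  + by rewrite (inj_eq (@rshift_inj _ _)) (negbTE ij).
- exact: index_enum_uniq.
exists e; congr (_ *: exterior_basis K _).
apply/setP => k; rewrite inE; apply/bigcupP.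
case: (split_ordP k) => l ->; exists l => //; rewrite !inE eqxx ?orbT //.
Qed.

(** * Quaternion conjugation and adjoint matrices *)

Section Quaternions.
Variable R : comNzRingType.
Implicit Types (a : R) (x y : quaternion R).

Lemma quaternion_ext x y : qre x = qre y -> qi x = qi y -> qj x = qj y ->
  qk x = qk y -> x = y.
Proof. by case: x y => ? ? ? ? [? ? ? ?] /= -> -> -> ->. Qed.

Lemma quaternion_mulE x y : x * y = Defs.mulq x y. Proof. by []. Qed.

Lemma qre_sub : zmod_morphism (@qre R). Proof. by []. Qed.
HB.instance Definition _ := GRing.isZmodMorphism.Build _ _ (@qre R) qre_sub.
Lemma qi_sub : zmod_morphism (@qi R). Proof. by []. Qed.
HB.instance Definition _ := GRing.isZmodMorphism.Build _ _ (@qi R) qi_sub.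
Lemma qj_sub : zmod_morphism (@qj R). Proof. by []. Qed.
HB.instance Definition _ := GRing.isZmodMorphism.Build _ _ (@qj R) qj_sub.
Lemma qk_sub : zmod_morphism (@qk R). Proof. by []. Qed.
HB.instance Definition _ := GRing.isZmodMorphism.Build _ _ (@qk R) qk_sub.

Lemma qconj_sub : zmod_morphism (@qconj R).
Proof. by move=> x y; apply: quaternion_ext => //=; rewrite opprD. Qed.
HB.instance Definition _ := GRing.isZmodMorphism.Build _ _ (@qconj R) qconj_sub.

Lemma qconjM x y : qconj (x * y) = qconj y * qconj x.
Proof. by rewrite !quaternion_mulE; congr Quaternion; rewrite /=; ring. Qed.

Lemma qconjK : involutive (@qconj R).
Proof. by case=> a b c d; rewrite /qconj /= !opprK. Qed.

Lemma qreal_sub : zmod_morphism (@qreal R).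
Proof. by move=> a b; apply: quaternion_ext => //=; rewrite ?subrr // oppr0 addr0. Qed.
HB.instance Definition _ := GRing.isZmodMorphism.Build _ _ (@qreal R) qreal_sub.

Lemma qreal_monoid : monoid_morphism (@qreal R).
Proof.
by split=> // a b; rewrite quaternion_mulE; apply: quaternion_ext => /=; ring.
Qed.
HB.instance Definition _ := GRing.isMonoidMorphism.Build _ _ (@qreal R) qreal_monoid.

Lemma qreal_comm a x : x * qreal a = qreal a * x.
Proof. by rewrite !quaternion_mulE; congr Quaternion; rewrite /=; ring. Qed.

Lemma qconj_real a : qconj (qreal a) = qreal a.
Proof. by rewrite /qconj /= oppr0. Qed.

Definition qsqnorm x := qre x ^+ 2 + qi x ^+ 2 + qj x ^+ 2 + qk x ^+ 2.

Lemma mulq_conj x : x * qconj x = qreal (qsqnorm x).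
Proof. by rewrite quaternion_mulE; congr Quaternion; rewrite /= /qsqnorm; ring. Qed.

Lemma mulq_conjl x : qconj x * x = qreal (qsqnorm x).
Proof. by rewrite quaternion_mulE; congr Quaternion; rewrite /= /qsqnorm; ring. Qed.

(** Extends [qadjoint] to rectangular matrices, so that rows have adjoints too. *)
Definition qadj m n (M : 'M[quaternion R]_(m, n)) := (map_mx (@qconj R) M)^T.

Lemma qadjM m n p (M : 'M[quaternion R]_(m, n)) (N : 'M_(n, p)) :
  qadj (M *m N) = qadj N *m qadj M.
Proof.
apply/matrixP => i j; rewrite !mxE raddf_sum; apply: eq_bigr => k _.
by rewrite /= qconjM !mxE.
Qed.

Lemma qadjK m n (M : 'M[quaternion R]_(m, n)) : qadj (qadj M) = M.
Proof. by apply/matrixP => i j; rewrite !mxE qconjK. Qed.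

Lemma qadjB m n : zmod_morphism (@qadj m n).
Proof. by move=> M N; apply/matrixP => i j; rewrite !mxE raddfB. Qed.

Lemma qadj_real m n a (M : 'M[quaternion R]_(m, n)) :
  qadj (qreal a *: M) = qreal a *: qadj M.
Proof. by apply/matrixP => i j; rewrite !mxE qconjM qconj_real qreal_comm. Qed.

Lemma qadj_scalar n a : qadj (qreal a)%:M = (qreal a)%:M :> 'M_n.
Proof.
apply/matrixP => i j; rewrite !mxE eq_sym.
by case: (i == j); rewrite ?mulr1n ?qconj_real // mulr0n raddf0.
Qed.

Lemma qadj1 n : qadj 1%:M = 1%:M :> 'M_n.
Proof. exact: qadj_scalar. Qed.

(** A scalar passes the left factor here because real quaternions are central. *)
Lemma qreal_scalemxAr m n p a (M : 'M[quaternion R]_(m, n)) (N : 'M_(n, p)) :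
  M *m (qreal a *: N) = qreal a *: (M *m N).
Proof.
apply/matrixP => i j; rewrite !mxE mulr_sumr; apply: eq_bigr => k _.
by rewrite !mxE !mulrA qreal_comm.
Qed.

Lemma qadj_block m1 m2 n1 n2 (A : 'M[quaternion R]_(m1, n1)) (B : 'M_(m1, n2))
    (C : 'M_(m2, n1)) (D : 'M_(m2, n2)) :
  qadj (block_mx A B C D) = block_mx (qadj A) (qadj C) (qadj B) (qadj D).
Proof. by rewrite /qadj map_block_mx tr_block_mx. Qed.

Definition row_sqnorm n (y : 'rV[quaternion R]_n) := \sum_j qsqnorm (y 0 j).

Lemma row_mulmx_adj n (y : 'rV[quaternion R]_n) :
  y *m qadj y = (qreal (row_sqnorm y))%:M.
Proof.
apply/matrixP => i j; rewrite !ord1 !mxE eqxx mulr1n raddf_sum /=.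
by apply: eq_bigr => k _; rewrite !mxE mulq_conj.
Qed.

End Quaternions.

(** * Norms of quaternionic rows and complex representations of matrices *)

Section RealQuaternions.
Variable R : rcfType.

Lemma qsqnorm_ge0 (x : quaternion R) : 0 <= qsqnorm x.
Proof. by rewrite /qsqnorm !addr_ge0 ?sqr_ge0. Qed.

Lemma qsqnorm_eq0 (x : quaternion R) : (qsqnorm x == 0) = (x == 0).
Proof.
apply/eqP/eqP => [|->]; last by rewrite /qsqnorm /= expr0n /= !addr0.
move/eqP; rewrite /qsqnorm !paddr_eq0 ?addr_ge0 ?sqr_ge0 // !sqrf_eq0.
by move=> /andP[/andP[/andP[/eqP ? /eqP ?] /eqP ?] /eqP ?]; apply: quaternion_ext.
Qed.

Lemma row_sqnorm_eq0 n (y : 'rV[quaternion R]_n) : (row_sqnorm y == 0) = (y == 0).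
Proof.
rewrite /row_sqnorm psumr_eq0 => [|j _]; last exact: qsqnorm_ge0.
apply/allP/eqP => [y0|-> j _ /=]; last by rewrite qsqnorm_eq0 mxE.
apply/rowP => j; rewrite mxE; apply/eqP; rewrite -qsqnorm_eq0.
exact: y0 (mem_index_enum j).
Qed.

Lemma row_sqnorm_gt0 n (y : 'rV[quaternion R]_n) : (0 < row_sqnorm y) = (y != 0).
Proof.
by rewrite lt0r row_sqnorm_eq0 sumr_ge0 ?andbT // => j _; apply: qsqnorm_ge0.
Qed.

Lemma Complex_congr (a a' b b' : R) : a = a' -> b = b' -> (a +i* b = a' +i* b')%C.
Proof. by move=> -> ->. Qed.

(* A quaternion is qcx x + qcy x * j with complex numbers qcx x and qcy x. *)
Definition qcx (x : quaternion R) : R[i] := (qre x +i* qi x)%C.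
Definition qcy (x : quaternion R) : R[i] := (qj x +i* qk x)%C.

Lemma qcx_sub : zmod_morphism qcx. Proof. by []. Qed.
HB.instance Definition _ := GRing.isZmodMorphism.Build _ _ qcx qcx_sub.
Lemma qcy_sub : zmod_morphism qcy. Proof. by []. Qed.
HB.instance Definition _ := GRing.isZmodMorphism.Build _ _ qcy qcy_sub.

Lemma qcxM x y : qcx (x * y) = qcx x * qcx y - qcy x * conjc (qcy y).
Proof.
by rewrite quaternion_mulE /qcx /qcy; apply: Complex_congr => /=; ring.
Qed.

Lemma qcyM x y : qcy (x * y) = qcx x * qcy y + qcy x * conjc (qcx y).
Proof.
by rewrite quaternion_mulE /qcx /qcy; apply: Complex_congr => /=; ring.
Qed.

Local Notation "M ^cc" := (map_mx conjc M) (at level 8, format "M ^cc").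
Local Notation mcx := (map_mx qcx).
Local Notation mcy := (map_mx qcy).

Lemma qmx_ext m n (M N : 'M[quaternion R]_(m, n)) :
  mcx M = mcx N -> mcy M = mcy N -> M = N.
Proof.
move=> /matrixP eqx /matrixP eqy; apply/matrixP => i j.
move: (eqx i j) (eqy i j); rewrite !mxE => -[? ?] [? ?].
exact: quaternion_ext.
Qed.

Lemma mcxM m n p (M : 'M[quaternion R]_(m, n)) (N : 'M_(n, p)) :
  mcx (M *m N) = mcx M *m mcx N - mcy M *m (mcy N)^cc.
Proof.
apply/matrixP => i j; rewrite !mxE raddf_sum -sumrB; apply: eq_bigr => k _.
by rewrite /= qcxM !mxE.
Qed.

Lemma mcyM m n p (M : 'M[quaternion R]_(m, n)) (N : 'M_(n, p)) :
  mcy (M *m N) = mcx M *m mcy N + mcy M *m (mcx N)^cc.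
Proof.
apply/matrixP => i j; rewrite !mxE raddf_sum -big_split; apply: eq_bigr => k _.
by rewrite /= qcyM !mxE.
Qed.

Lemma map_mx_conjcK m n (M : 'M[R[i]]_(m, n)) : (M^cc)^cc = M.
Proof. by apply/matrixP => i j; rewrite !mxE conjcK. Qed.

Lemma mcxM_conj m n p (M : 'M[quaternion R]_(m, n)) (N : 'M_(n, p)) :
  (mcx (M *m N))^cc = (mcx M)^cc *m (mcx N)^cc - (mcy M)^cc *m mcy N.
Proof. by rewrite mcxM map_mxB !map_mxM map_mx_conjcK. Qed.

Lemma mcyM_conj m n p (M : 'M[quaternion R]_(m, n)) (N : 'M_(n, p)) :
  (mcy (M *m N))^cc = (mcx M)^cc *m (mcy N)^cc + (mcy M)^cc *m mcx N.
Proof. by rewrite mcyM map_mxD !map_mxM map_mx_conjcK. Qed.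

(** The usual multiplicative complex matrix of P + Q j. *)
Definition complex_rep m n (M : 'M[quaternion R]_(m, n)) : 'M[R[i]]_(m + m, n + n) :=
  block_mx (mcx M) (- mcy M) (mcy M)^cc (mcx M)^cc.

(* complex_rep M times the block matrix [[0, 1], [-1, 0]] *)
Definition skew_rep m n (M : 'M[quaternion R]_(m, n)) : 'M[R[i]]_(m + m, n + n) :=
  block_mx (mcy M) (mcx M) (- (mcx M)^cc) (mcy M)^cc.

Lemma skew_repEul n (M : 'M[quaternion R]_n) l k :
  skew_rep M (lshift n l) (lshift n k) = qcy (M l k).
Proof. by rewrite block_mxEul mxE. Qed.

Lemma skew_repEur n (M : 'M[quaternion R]_n) l k :
  skew_rep M (lshift n l) (rshift n k) = qcx (M l k).
Proof. by rewrite block_mxEur mxE. Qed.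

Lemma skew_repEdl n (M : 'M[quaternion R]_n) l k :
  skew_rep M (rshift n l) (lshift n k) = - conjc (qcx (M l k)).
Proof. by rewrite block_mxEdl !mxE. Qed.

Lemma skew_repEdr n (M : 'M[quaternion R]_n) l k :
  skew_rep M (rshift n l) (rshift n k) = conjc (qcy (M l k)).
Proof. by rewrite block_mxEdr !mxE. Qed.

Lemma skew_repMl m n p (X : 'M[quaternion R]_(m, n)) (M : 'M_(n, p)) :
  skew_rep (X *m M) = complex_rep X *m skew_rep M.
Proof.
rewrite mulmx_block /skew_rep mcxM_conj mcyM_conj mcxM mcyM.
rewrite !mulNmx !mulmxN !opprK opprB.
by congr block_mx; rewrite addrC.
Qed.

(** For J = [[0, 1], [-1, 0]], the complex matrix Z of X satisfies Z^* J = J Z^T; this is why an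
    adjoint becomes a plain transpose. *)
Lemma skew_repMr m n p (M : 'M[quaternion R]_(m, n)) (X : 'M_(p, n)) :
  skew_rep (M *m qadj X) = skew_rep M *m (complex_rep X)^T.
Proof.
have adjx : mcx (qadj X) = ((mcx X)^cc)^T by apply/matrixP => i j; rewrite !mxE.
have adjy : mcy (qadj X) = - (mcy X)^T by apply/matrixP => i j; rewrite !mxE.
have adjxc : (mcx (qadj X))^cc = (mcx X)^T.
  by apply/matrixP => i j; rewrite !mxE /= opprK.
have adjyc : (mcy (qadj X))^cc = - ((mcy X)^cc)^T.
  by apply/matrixP => i j; rewrite !mxE.
rewrite tr_block_mx mulmx_block /skew_rep mcxM_conj mcyM_conj mcxM mcyM.
have trN : (- mcy X)^T = - (mcy X)^T by apply/matrixP => i j; rewrite !mxE.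
rewrite adjxc adjyc adjx adjy trN !mulmxN !mulNmx !opprK opprD.
rewrite [mcy M *m (mcx X)^T - _]addrC.
by rewrite [mcy M *m ((mcy X)^cc)^T + _]addrC.
Qed.

Lemma skew_rep_conj n (E M : 'M[quaternion R]_n) :
  skew_rep (E *m M *m qadj E) = complex_rep E *m skew_rep M *m (complex_rep E)^T.
Proof. by rewrite skew_repMr skew_repMl. Qed.

Lemma skew_repD m n : {morph @skew_rep m n : M N / M + N}.
Proof.
by move=> M N; rewrite /skew_rep add_block_mx !raddfD /= -opprD.
Qed.

Lemma skew_repZ m n a (M : 'M[quaternion R]_(m, n)) :
  skew_rep (qreal a *: M) = a%:C%C *: skew_rep M.
Proof.
have x0 (z : quaternion R) : qcx (qreal a * z) = a%:C%C * qcx z.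
  by rewrite qcxM [qcy _](_ : _ = 0) // mul0r subr0.
have y0 (z : quaternion R) : qcy (qreal a * z) = a%:C%C * qcy z.
  by rewrite qcyM [qcy (qreal a)](_ : _ = 0) // mul0r addr0.
have x0c z : conjc (qcx (qreal a * z)) = a%:C%C * conjc (qcx z).
  by rewrite x0 rmorphM; congr (_ * _); rewrite /= oppr0.
have y0c z : conjc (qcy (qreal a * z)) = a%:C%C * conjc (qcy z).
  by rewrite y0 rmorphM; congr (_ * _); rewrite /= oppr0.
rewrite scale_block_mx; congr block_mx; apply/matrixP => i j; rewrite !mxE.
- exact: y0.
- exact: x0.
- by rewrite x0c mulrN.
- exact: y0c.
Qed.

Lemma skew_rep_diag n (nu : 'rV[R]_n) :
  skew_rep (diag_mx (map_mx (@qreal R) nu)) =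
  symplectic_mx (map_mx (real_complex R) nu).
Proof.
have dx : mcx (diag_mx (map_mx (@qreal R) nu)) = diag_mx (map_mx (real_complex R) nu).
  by apply/matrixP => i j; rewrite !mxE raddfMn.
have dy : mcy (diag_mx (map_mx (@qreal R) nu)) = 0.
  by apply/matrixP => i j; rewrite !mxE raddfMn /= [qcy _](_ : _ = 0) ?mul0rn.
rewrite /skew_rep dx dy raddf0; congr block_mx; congr (- _).
by apply/matrixP => i j; rewrite !mxE rmorphMn; congr (_ *+ _); rewrite /= oppr0.
Qed.

End RealQuaternions.

(** * Unitary diagonalization of hyperhermitian matrices *)

Section QuaternionicSpectralTheorem.
Variable R : rcfType.

Definition quaternion_of_pair (a b : R[i]) : quaternion R :=
  Quaternion (complex.Re a) (complex.Im a) (complex.Re b) (complex.Im b).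

Lemma qcx_pair a b : qcx (quaternion_of_pair a b) = a. Proof. by case: a. Qed.
Lemma qcy_pair a b : qcy (quaternion_of_pair a b) = b. Proof. by case: b. Qed.

(** A complex row eigenvector (v1, v2) of [complex_rep M] folds into the quaternionic row v1 - v2 j;
    its two block equations are the two complex components of the claim. *)
Lemma complex_eigenvector n (M : 'M[quaternion R]_n.+1) :
  exists (a : R[i]) (y : 'rV[quaternion R]_n.+1),
    y != 0 /\ y *m M = quaternion_of_pair a 0 *: y.
Proof.
have [a /eigenvalueP[v vM v0]] :=
  @eigenvalue_closed R[i] (n.+1 + n.+1) (complex_rep M) isT.
exists a; set v1 := lsubmx v; set v2 := rsubmx v.
pose y : 'rV[quaternion R]_n.+1 := \row_j quaternion_of_pair (v1 0 j) (- v2 0 j).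
have yx : map_mx (@qcx R) y = v1 by apply/rowP => j; rewrite mxE [y _ _]mxE qcx_pair.
have yy : map_mx (@qcy R) y = - v2.
  by apply/rowP => j; rewrite [LHS]mxE [y _ _]mxE qcy_pair [RHS]mxE.
move: vM; rewrite -[v]hsubmxK -/v1 -/v2 mul_row_block scale_row_mx.
move=> /eq_row_mx[eq1 eq2].
exists y; split.
  apply: contraNneq v0 => y0; rewrite -[v]hsubmxK -/v1 -/v2.
  have -> : v1 = 0 by rewrite -yx y0 raddf0.
  have -> : v2 = 0 by apply: oppr_inj; rewrite -yy y0 oppr0 raddf0.
  by rewrite row_mx0.
have scx : map_mx (@qcx R) (quaternion_of_pair a 0 *: y) = a *: map_mx (@qcx R) y.
  by apply/rowP => j; rewrite !mxE qcxM qcx_pair qcy_pair mul0r subr0.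
have scy : map_mx (@qcy R) (quaternion_of_pair a 0 *: y) = a *: map_mx (@qcy R) y.
  by apply/rowP => j; rewrite !mxE qcyM qcx_pair qcy_pair mul0r addr0.
apply: qmx_ext; first by rewrite mcxM scx yx yy mulNmx opprK.
by rewrite mcyM scy yx yy mulNmx scalerN -eq2 opprD mulmxN opprK.
Qed.

(** A real eigenvalue is central, so y may be rescaled on the left by a nonzero quaternion; the
    normalization is the one [householder] requires. *)
Lemma real_eigenvector n (M : 'M[quaternion R]_n.+1) : qadj M = M ->
  exists (a c : R) (y : 'rV[quaternion R]_n.+1),
    [/\ y *m M = qreal a *: y, y *m qadj y = 1%:M & y 0 0 = qreal c].
Proof.
move=> Mh; have [a [y [y0 yM]]] := complex_eigenvector M.
(* y M y^* = a (y y^* ) is self-adjoint and y y^* is a nonzero real number. *)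
have aR : quaternion_of_pair a 0 = qreal (complex.Re a).
  have: qadj (y *m M *m qadj y) = y *m M *m qadj y.
    by rewrite !qadjM qadjK Mh mulmxA.
  rewrite yM -scalemxAl row_mulmx_adj => /matrixP/(_ 0 0); rewrite !mxE mulr1n.
  have : row_sqnorm y != 0 by rewrite row_sqnorm_eq0.
  move: (row_sqnorm y) => r r0; rewrite !quaternion_mulE => /(congr1 (@qi R)) ai.
  rewrite /quaternion_of_pair /qreal /=; congr Quaternion.
  move: ai => /= /eqP; rewrite !(mulr0, mul0r, addr0, subr0, add0r) eq_sym -addr_eq0.
  rewrite -mulr2n -mulr_natr mulf_eq0 pnatr_eq0 orbF mulf_eq0 (negbTE r0) orbF.
  exact: eqP.
rewrite {}aR in yM; move: (complex.Re a) yM => {}a yM.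
(* Multiplying y on the left by g makes its first entry real. *)
pose g : quaternion R := if y 0 0 == 0 then 1 else qconj (y 0 0).
have g0 : qsqnorm g != 0.
  rewrite qsqnorm_eq0 /g; case: ifP => [_|/negP yn]; first exact: oner_neq0.
  by apply/negP => /eqP/(congr1 (@qconj R)); rewrite qconjK raddf0 => /eqP.
pose z := g *: y.
have z0 : z != 0.
  apply: contraNneq y0 => z0; apply/eqP/rowP => j.
  move/rowP/(_ j): z0; rewrite !mxE => /(congr1 ( *%R (qconj g))).
  rewrite mulr0 mulrA mulq_conjl => /(congr1 ( *%R (qreal (qsqnorm g)^-1))).
  by rewrite mulr0 mulrA -rmorphM /= mulVf // rmorph1 mul1r.
have zM : z *m M = qreal a *: z by rewrite -scalemxAl yM !scalerA qreal_comm.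
have [c zc] : exists c, z 0 0 = qreal c.
  rewrite mxE /g; case: eqP => [->|_]; first by exists 0; rewrite mulr0 raddf0.
  by eexists; apply: mulq_conjl.
pose s := (Num.sqrt (row_sqnorm z))^-1.
exists a, (s * c), (qreal s *: z); split.
- by rewrite -scalemxAl zM !scalerA qreal_comm.
- rewrite qadj_real qreal_scalemxAr -scalemxAl row_mulmx_adj scalerA.
  rewrite scale_scalar_mx -!rmorphM /= -expr2 /s exprVn sqr_sqrtr; last first.
    by rewrite ltW // row_sqnorm_gt0.
  by rewrite mulVf ?row_sqnorm_eq0.
- by rewrite mxE zc -rmorphM.
Qed.

(* H is the reflection in w = y - e; if c = 1 then w = 0, and the junk value
   0^-1 = 0 makes H the identity. *)
Lemma householder n (y : 'rV[quaternion R]_n.+1) (c : R) :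
  y *m qadj y = 1%:M -> y 0 0 = qreal c ->
  exists H, [/\ qadj H = H, H *m H = 1%:M & delta_mx 0 0 *m H = y].
Proof.
move=> yy y0; pose e : 'rV[quaternion R]_n.+1 := delta_mx 0 0.
pose w := y - e.
have dy (z : 'rV[quaternion R]_n.+1) : z *m qadj e = (z 0 0)%:M.
  apply/matrixP => i j; rewrite !ord1 !mxE (bigD1 0) //= big1 => [|k k0].
    by rewrite !mxE !eqxx /= qconj_real mulr1 addr0 mulr1n.
  by rewrite !mxE /= (negbTE k0) /= raddf0 mulr0.
have ye : y *m qadj e = (qreal c)%:M by rewrite dy y0.
have ey : e *m qadj y = (qreal c)%:M by rewrite -[LHS]qadjK qadjM qadjK ye qadj_scalar.
have ee : e *m qadj e = 1%:M by rewrite dy mxE.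
have qw : qadj w = qadj y - qadj e by rewrite /w qadjB.
have ew : e *m qadj w = qreal (c - 1) *: 1%:M.
  by rewrite qw mulmxBr ey ee scale_scalar_mx mulr1 raddfB /= raddfB.
have ww : w *m qadj w = qreal (2 * (1 - c)) *: 1%:M.
  rewrite {1}/w mulmxBl ew qw mulmxBr yy ye scale_scalar_mx mulr1 -!raddfB /=.
  rewrite scale_scalar_mx mulr1; congr (_%:M).
  by rewrite -(rmorph1 (@qreal R)) -!raddfB /=; congr qreal; ring.
(* Since w has squared norm 2 (1 - c), s is the usual factor 2 / |w|^2 of a reflection. *)
pose s := (1 - c)^-1; pose P := qadj w *m w.
have PP : P *m P = qreal (2 * (1 - c)) *: P.
  by rewrite /P mulmxA -(mulmxA (qadj w)) ww qreal_scalemxAr mulmx1 -scalemxAl.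
have sP : qreal (s * s * (2 * (1 - c))) *: P = qreal s *: P + qreal s *: P.
  rewrite -scalerDl -raddfD /=; congr (qreal _ *: P); rewrite /s.
  have [->|c1] := eqVneq (1 - c) 0; first by rewrite invr0 !mul0r addr0.
  by rewrite -mulrA (mulrCA _ 2) mulVf // mulr1 mulr_natr mulr2n.
exists (1%:M - qreal s *: P); split.
- by rewrite qadjB qadj1 qadj_real qadjM qadjK.
- rewrite mulmxBl mul1mx mulmxBr mulmx1 qreal_scalemxAr -scalemxAl PP !scalerA.
  by rewrite -!rmorphM /= sP opprB addrK subrK.
- rewrite mulmxBr mulmx1 qreal_scalemxAr mulmxA ew -!scalemxAl mul1mx scalerA.
  rewrite -rmorphM /= /s; have [c1|c1] := eqVneq (1 - c) 0.
    (* For c = 1 the squared norm of w is 0, so y is already the first basis row. *)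
    rewrite c1 invr0 mul0r raddf0 scale0r subr0.
    apply/esym/eqP; rewrite -subr_eq0 -/w -row_sqnorm_eq0.
    move: ww; rewrite row_mulmx_adj c1 mulr0 raddf0 scale0r => /matrixP/(_ 0 0).
    by rewrite !mxE => /(congr1 (@qre R)) /= ->.
  rewrite -(opprB 1 c) mulrN mulVf // raddfN scaleNr opprK scale1r.
  by rewrite addrC subrK.
Qed.

(** The first column is the adjoint of the first row, so it vanishes off the diagonal as well. *)
Lemma hyperhermitian_deflation n (M : 'M[quaternion R]_(1 + n)) a :
  qadj M = M -> (forall j, M 0 j = qreal a * (j == 0)%:R) ->
  M = block_mx (qreal a)%:M 0 0 (drsubmx M).
Proof.
move=> Mh rowM; rewrite -[LHS]submxK.
have ul : ulsubmx M = (qreal a)%:M.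
  apply/matrixP => i j; rewrite !ord1 mxE mxE lshift0.
  by rewrite rowM mxE !eqxx mulr1 mulr1n.
have ur : ursubmx M = 0.
  apply/matrixP => i j; rewrite !ord1 mxE mxE lshift0.
  by rewrite rowM mxE mulr0.
have dl : dlsubmx M = qadj (ursubmx M).
  by rewrite -[in LHS]Mh; apply/matrixP => i j; rewrite !mxE.
by rewrite ul dl ur /qadj map_mx0 trmx0.
Qed.

(** Induction on n: conjugation by a Householder matrix H splits off a real eigenvalue, and the
    remaining block is again hyperhermitian. *)
Lemma quaternionic_spectral n (M : 'M[quaternion R]_n) : qadj M = M ->
  exists (E : 'M[quaternion R]_n) (nu : 'rV[R]_n),
    [/\ qadj E *m E = 1%:M, E *m qadj E = 1%:M
      & qadj E *m M *m E = diag_mx (map_mx (@qreal R) nu)].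
Proof.
elim: n M => [|n IHn] M Mh.
  by exists 1%:M, 0; split; apply/matrixP => -[].
have [a [c [y [yM yy y0]]]] := real_eigenvector Mh.
have [H [Hh HH Hy]] := householder yy y0.
pose M1 := H *m M *m H.
have M1h : qadj M1 = M1 by rewrite !qadjM Hh Mh mulmxA.
have rowM1 j : M1 0 j = qreal a * (j == 0)%:R.
  (* With e the first basis row, e H M H = y M H = a y H = a e, as e H = y and H is an
     involution. *)
  have: delta_mx 0 0 *m M1 = qreal a *: delta_mx 0 0 :> 'rV_n.+1.
    by rewrite !mulmxA Hy yM -scalemxAl -Hy -mulmxA HH mulmx1.
  by rewrite -rowE => /rowP/(_ j); rewrite !mxE.
have M1E := @hyperhermitian_deflation n M1 a M1h rowM1.
have drh : qadj (@drsubmx _ 1 n 1 n M1) = @drsubmx _ 1 n 1 n M1.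
  by rewrite -[in RHS]M1h; apply/matrixP => i j; rewrite !mxE.
have [E' [nu [E'E EE' D]]] := IHn _ drh.
pose E1 : 'M[quaternion R]_(1 + n) := block_mx 1%:M 0 0 E'.
have E1a : qadj E1 = block_mx 1%:M 0 0 (qadj E').
  by rewrite qadj_block qadj1 /qadj !map_mx0 !trmx0.
have E1E : qadj E1 *m E1 = 1%:M.
  rewrite E1a mulmx_block !(mul0mx, mulmx0, mulmx1, addr0, add0r) E'E.
  by rewrite -scalar_mx_block.
have EE1 : E1 *m qadj E1 = 1%:M.
  rewrite E1a mulmx_block !(mul0mx, mulmx0, mulmx1, addr0, add0r) EE'.
  by rewrite -scalar_mx_block.
exists (H *m E1), (row_mx a%:M nu); split.
- by rewrite qadjM Hh mulmxA -(mulmxA (qadj E1)) HH mulmx1.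
- by rewrite qadjM Hh mulmxA -(mulmxA H) EE1 mulmx1.
transitivity (qadj E1 *m (M1 : 'M_(1 + n)) *m E1); first by rewrite qadjM Hh !mulmxA.
rewrite M1E E1a !mulmx_block !(mul0mx, mul1mx, mulmx0, mulmx1, addr0, add0r) D.
have aE : map_mx (@qreal R) (a%:M : 'M_1) = (qreal a)%:M by rewrite map_scalar_mx.
have dE : diag_mx (map_mx (@qreal R) (row_mx (a%:M : 'M_1) nu)) =
    block_mx (qreal a)%:M 0 0 (diag_mx (map_mx (@qreal R) nu)).
  rewrite map_row_mx diag_mx_row aE; congr block_mx.
  by apply/matrixP => i j; rewrite !ord1 !mxE.
exact: esym dE.
Qed.

End QuaternionicSpectralTheorem.

Import numFieldNormedType.Exports.

(** * Symmetry of second directional derivatives *)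

Section MixedDerivatives.
Variables (R : realType) (V : normedModType R).
Implicit Types (u : V -> R) (v w x : V).

Lemma is_derive_line u v x (s : R) : (forall y, derivable u y v) ->
  is_derive s 1 (fun t : R => u (x + t *: v)) ('D_v u (x + s *: v)).
Proof.
move=> du.
have E : (fun h : R => h^-1 *:
    (((fun t : R => u (x + t *: v)) \o shift s) (h *: (1 : R)) - u (x + s *: v))) =
         (fun h : R => h^-1 *: ((u \o shift (x + s *: v)) (h *: v) - u (x + s *: v))).
  apply: boolp.funext => h /=; congr (_ *: (u _ - _)).
  by rewrite [h *: 1]mulr1 scalerDl addrCA addrA.
by apply: DeriveDef; [rewrite /derivable E; apply: du | rewrite /derive E].
Qed.

Lemma MVT_from0 (f df : R -> R) (h : R) : 0 < h ->
  (forall s : R, is_derive s 1 f (df s)) ->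
  exists2 s, 0 < s < h & f h - f 0 = df s * h.
Proof.
move=> h0 fdf; have [|s] := @MVT R f df 0 h h0 (fun s _ => fdf s).
  apply: continuous_subspaceT => s.
  apply: differentiable_continuous; apply/derivable1_diffP.
  by have [] := fdf s.
by rewrite in_itv /= subr0 => sI E; exists s.
Qed.

Definition second_difference u v w x h :=
  u (x + h *: v + h *: w) - u (x + h *: v) - u (x + h *: w) + u x.

Lemma second_differenceC u v w x h :
  second_difference u v w x h = second_difference u w v x h.
Proof. by rewrite /second_difference (addrAC x); ring. Qed.

(** The mean value theorem is used twice: along v for the increment of u in the direction w, then
    along w for the derivative of u along v. *)
Lemma second_difference_MVT u v w x h : 0 < h ->
  (forall y, derivable u y v) -> (forall y, derivable ('D_v u) y w) ->
  exists s t, [/\ 0 < s < h, 0 < t < h &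
    second_difference u v w x h = 'D_w ('D_v u) (x + s *: v + t *: w) * h * h].
Proof.
move=> h0 du ddu.
pose phi (s : R) := u (x + h *: w + s *: v) - u (x + s *: v).
have dphi (s : R) : is_derive s 1 phi
    ('D_v u (x + h *: w + s *: v) - 'D_v u (x + s *: v)).
  by apply: is_deriveB; apply: is_derive_line.
have [s sI phiE] := MVT_from0 h0 dphi.
have [t tI tE] := MVT_from0 h0 (fun t => is_derive_line (x + s *: v) t ddu).
exists s, t; split=> //; rewrite -tE scale0r addr0 [x + _ + h *: w]addrAC -phiE.
by rewrite /second_difference /phi scale0r !addr0 (addrAC x); ring.
Qed.

(** The equality in the hypotheses comes from one second difference computed in two ways; cancelling
    h twice leaves a triangle inequality. *)
Lemma dist_lt_split (a a' b b' h e : R) : h != 0 -> a' * h * h = b' * h * h ->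
  `|a - a'| < e -> `|b - b'| < e -> `|a - b| < e + e.
Proof.
move=> h0 /(mulIf h0)/(mulIf h0)-> ae be.
by rewrite -(subrKA b') (le_lt_trans (ler_normD _ _)) // ltrD // distrC.
Qed.

(** Schwarz's theorem: the second difference is symmetric in v and w, so arbitrarily near x the two
    mixed derivatives take a common value, each at a point of its own; continuity concludes. *)
Lemma derive_comm u v w x :
  (forall y, derivable u y v) -> (forall y, derivable u y w) ->
  (forall y, derivable ('D_v u) y w) -> (forall y, derivable ('D_w u) y v) ->
  {for x, continuous ('D_w ('D_v u))} -> {for x, continuous ('D_v ('D_w u))} ->
  'D_w ('D_v u) x = 'D_v ('D_w u) x.
Proof.
move=> uv uw uvw uwv cF cG; apply/eqP; rewrite -subr_eq0 -normr_eq0.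
apply/negP => /negP n0; set F := 'D_w _ in cF n0; set G := 'D_v ('D_w u) in cG n0.
(* Two errors below half of the supposed gap add up to less than the gap. *)
have {n0} e0 : 0 < `|F x - G x| / 2 by rewrite divr_gt0 // lt0r n0 normr_ge0.
set e := _ / 2 in e0.
have [d1 d10 Fd] : exists2 d, 0 < d & forall y, `|x - y| < d -> `|F x - F y| < e.
  have /cvgrPdist_lt/(_ e e0)/nbhs_ballP[d d0 dF] := cF.
  exists d => // y xy; apply: dF; rewrite -ball_normE; exact: xy.
have [d2 d20 Gd] : exists2 d, 0 < d & forall y, `|x - y| < d -> `|G x - G y| < e.
  have /cvgrPdist_lt/(_ e e0)/nbhs_ballP[d d0 dG] := cG.
  exists d => // y xy; apply: dG; rewrite -ball_normE; exact: xy.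
(* The points to be reached are within h (|v| + |w|) of x; the added 1 makes K positive even for v =
   w = 0 and the final bound strict. *)
pose K := `|v| + `|w| + 1; pose h := Num.min d1 d2 / K.
have K0 : 0 < K by rewrite ltr_wpDl ?addr_ge0.
have h0 : 0 < h by rewrite divr_gt0 // lt_min d10 d20.
have close s t v' w' : `|v'| + `|w'| = `|v| + `|w| ->
    0 < s < h -> 0 < t < h -> `|x - (x + s *: v' + t *: w')| < Num.min d1 d2.
  move=> vw /andP[s0 sh] /andP[t0 th].
  rewrite -addrA opprD addrA subrr sub0r normrN.
  apply: le_lt_trans (ler_normD _ _) _; rewrite !normrZ !gtr0_norm //.
  apply: (@le_lt_trans _ _ (h * (`|v'| + `|w'|))).
    by rewrite mulrDr lerD // ler_wpM2r // ltW.
  by rewrite vw /h -mulrA gtr_pMr ?lt_min ?d10 // mulrC ltr_pdivrMr // mul1r /K ltrDl.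
have [s [t [sI tI E1]]] := second_difference_MVT x h0 uv uvw.
have [s' [t' [sI' tI' E2]]] := second_difference_MVT x h0 uw uwv.
have := close _ _ v w erefl sI tI; rewrite lt_min => /andP[/Fd Fe _].
have := close _ _ w v (addrC _ _) sI' tI'; rewrite lt_min => /andP[_ /Gd Ge].
have FG : F (x + s *: v + t *: w) * h * h = G (x + s' *: w + t' *: v) * h * h.
  exact: etrans (esym E1) (etrans (second_differenceC _ _ _ _ _) E2).
have := dist_lt_split (lt0r_neq0 h0) FG Fe Ge.
by rewrite /e -splitr ltxx.
Qed.

End MixedDerivatives.

(** * The quaternionic Hessian and the Baston coefficients in real coordinates *)

Section HessianBaston.
Variables (R : realType) (n : nat).
Implicit Types (u : Hn R n -> R) (l k : 'I_n) (b c : 'I_4) (q : Hn R n).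

Lemma partial_comm u l b k c q : Ck 2 u ->
  partial l b (partial k c u) q = partial k c (partial l b u) q.
Proof.
move=> -[_ u1]; have [dk [_ u1k]] := u1 k c; have [dl [_ u1l]] := u1 l b.
have [dkl [ckl _]] := u1k l b; have [dlk [clk _]] := u1l k c.
exact: (@derive_comm R _ u (delta_mx k c) (delta_mx l b) q dk dl dkl dlk
  (ckl q) (clk q)).
Qed.

Lemma partial_cst l b (a : R) q : partial l b (fun=> a) q = 0.
Proof. exact: derive_cst. Qed.

Lemma partialN l b u q : derivable u q (delta_mx l b) ->
  partial l b (fun x => - u x) q = - partial l b u q.
Proof. by move=> du; rewrite /partial (deriveN du). Qed.

Lemma sum_ord4 (V : nmodType) (F : 'I_4 -> V) :
  \sum_b F b = F (inord 0) + F (inord 1) + F (inord 2) + F (inord 3).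
Proof.
rewrite !big_ord_recr big_ord0 /= add0r.
by congr (F _ + F _ + F _ + F _); apply: val_inj; rewrite /= inordK.
Qed.

Lemma dq_real u k q : dq k (fun x => qreal (u x)) q =
  Quaternion (partial k (inord 0) u q) (- partial k (inord 1) u q)
             (- partial k (inord 2) u q) (- partial k (inord 3) u q).
Proof.
rewrite /dq sum_ord4 /qpartial /= !partial_cst.
move: (partial _ (inord 0) _ _) (partial _ (inord 1) _ _) => a0 a1.
move: (partial _ (inord 2) _ _) (partial _ (inord 3) _ _) => a2 a3.
rewrite !quaternion_mulE /qunit /qconj /= !inordK //.
by apply: quaternion_ext => /=; ring.
Qed.

(* The (l, k) entry of the Hessian, with D b c = partial l b (partial k c u) q. *)
Definition hessian_entry (D : 'I_4 -> 'I_4 -> R) : quaternion R :=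
  let o0 := inord 0 in let o1 := inord 1 in
  let o2 := inord 2 in let o3 := inord 3 in
  Quaternion (D o0 o0 + D o1 o1 + D o2 o2 + D o3 o3)
             (D o1 o0 - D o0 o1 - D o2 o3 + D o3 o2)
             (D o2 o0 - D o0 o2 + D o1 o3 - D o3 o1)
             (D o3 o0 - D o0 o3 - D o1 o2 + D o2 o1).

Lemma hessian_entry_sum D : \sum_b qunit R b * Quaternion
    (D b (inord 0)) (- D b (inord 1)) (- D b (inord 2)) (- D b (inord 3)) =
  hessian_entry D.
Proof.
rewrite sum_ord4 /qunit !inordK // !quaternion_mulE.
by apply: quaternion_ext => /=; ring.
Qed.

(** Conjugation exchanges b and c in the product of e_b with the conjugate of e_c. *)
Lemma qconj_hessian_entry D :
  qconj (hessian_entry D) = hessian_entry (fun b c => D c b).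
Proof. by apply: quaternion_ext => /=; ring. Qed.

Lemma partial2N u l b k c q : Ck 2 u ->
  partial l b (fun x => - partial k c u x) q = - partial l b (partial k c u) q.
Proof. by case=> _ /(_ k c)[_ [_ /(_ l b)[du _]]]; apply: partialN. Qed.

Lemma qhessianE u q l k : Ck 2 u ->
  qhessian u q l k = hessian_entry (fun b c => partial l b (partial k c u) q).
Proof.
move=> u2; rewrite mxE (boolp.funext (dq_real u k)) -hessian_entry_sum.
apply: eq_bigr => b _; congr (_ * _).
by apply: quaternion_ext; [exact: erefl | exact: partial2N ..].
Qed.

Lemma qhessian_hyperhermitian u q : Ck 2 u -> qadj (qhessian u q) = qhessian u q.
Proof.
move=> u2; apply/matrixP => l k.
have sym : (fun b c => partial k c (partial l b u) q) =
           (fun b c => partial l b (partial k c u) q).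
  by apply: boolp.funext => b; apply: boolp.funext => c; exact: partial_comm.
rewrite (qhessianE q l k u2) -sym 2!mxE (qhessianE q k l u2).
exact: qconj_hessian_entry.
Qed.

Lemma addcI (a b c d : R) : ((a +i* b) + 'i * (c +i* d) = (a - d) +i* (b + c))%C.
Proof. by apply/eqP; rewrite eq_complex /=; apply/andP; split; apply/eqP; ring. Qed.

Lemma subcI (a b c d : R) : ((a +i* b) - 'i * (c +i* d) = (a + d) +i* (b - c))%C.
Proof. by apply/eqP; rewrite eq_complex /=; apply/andP; split; apply/eqP; ring. Qed.

Lemma nabla1_lshift u k :
  nabla1 (lshift n k) (fun x => (u x)%:C%C) =
  (fun q => ((- partial k (inord 2) u q) +i* (- partial k (inord 3) u q))%C).
Proof.
apply: boolp.funext => q; rewrite /nabla1 (unsplitK (inl k)) /cpartial /=.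
by rewrite !partial_cst subcI addr0 !oppr0 sub0r.
Qed.

Lemma nabla1_rshift u k :
  nabla1 (rshift n k) (fun x => (u x)%:C%C) =
  (fun q => (partial k (inord 0) u q +i* (- partial k (inord 1) u q))%C).
Proof.
apply: boolp.funext => q; rewrite /nabla1 (unsplitK (inr k)) /cpartial /=.
by rewrite !partial_cst subcI addr0 sub0r.
Qed.

Lemma nabla0_lshift l (g h : Hn R n -> R) q :
  nabla0 (lshift n l) (fun x => (g x +i* h x)%C) q =
  ((partial l (inord 0) g q - partial l (inord 1) h q)
   +i* (partial l (inord 0) h q + partial l (inord 1) g q))%C.
Proof. by rewrite /nabla0 (unsplitK (inl l)); exact: addcI. Qed.

Lemma nabla0_rshift l (g h : Hn R n -> R) q :
  nabla0 (rshift n l) (fun x => (g x +i* h x)%C) q =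
  ((partial l (inord 2) g q + partial l (inord 3) h q)
   +i* (partial l (inord 2) h q - partial l (inord 3) g q))%C.
Proof. by rewrite /nabla0 (unsplitK (inr l)); exact: subcI. Qed.

Lemma add_congr (V : zmodType) (a a' b b' : V) : a = a' -> b = b' -> a + b = a' + b'.
Proof. by move=> -> ->. Qed.

(* The values at q of nabla_(A0') nabla_(B1') u for the indices A in {l, n + l}
   and B in {k, n + k}, with D as in [hessian_entry]. *)
Section NablaNabla.
Variable D : 'I_4 -> 'I_4 -> R.
Local Notation d b c := (D (inord b) (inord c)).

Definition nabla01_ll := ((- d 0 2 - - d 1 3) +i* (- d 0 3 + - d 1 2))%C.
Definition nabla01_lr := ((d 0 0 - - d 1 1) +i* (- d 0 1 + d 1 0))%C.
Definition nabla01_rl := ((- d 2 2 + - d 3 3) +i* (- d 2 3 - - d 3 2))%C.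
Definition nabla01_rr := ((d 2 0 + - d 3 1) +i* (- d 2 1 - d 3 0))%C.
End NablaNabla.

(** The transposed argument stands for the term with A and B exchanged; the four identities of this
    kind are the blocks of [baston_coef_skew_rep]. *)
Lemma nabla01_ll_skew D :
  nabla01_ll D - nabla01_ll (fun b c => D c b) = qcy (hessian_entry D).
Proof. by apply: Complex_congr => /=; ring. Qed.

Lemma nabla01_lr_skew D :
  nabla01_lr D - nabla01_rl (fun b c => D c b) = qcx (hessian_entry D).
Proof. by apply: Complex_congr => /=; ring. Qed.

Lemma nabla01_rl_skew D :
  nabla01_rl D - nabla01_lr (fun b c => D c b) = - conjc (qcx (hessian_entry D)).
Proof. by apply: Complex_congr => /=; ring. Qed.

Lemma nabla01_rr_skew D :
  nabla01_rr D - nabla01_rr (fun b c => D c b) = conjc (qcy (hessian_entry D)).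
Proof. by apply: Complex_congr => /=; ring. Qed.

Section NablaNablaTheory.
Variables (u : Hn R n -> R) (u2 : Ck 2 u) (q : Hn R n).
Local Notation D l k := (fun b c => partial l b (partial k c u) q).
Local Notation uC := (fun x => (u x)%:C%C).

Lemma nabla01_llE l k :
  nabla0 (lshift n l) (nabla1 (lshift n k) uC) q = nabla01_ll (D l k).
Proof.
rewrite nabla1_lshift nabla0_lshift; apply: Complex_congr; apply: add_congr;
  [|congr (- _)| |]; exact: partial2N.
Qed.

Lemma nabla01_lrE l k :
  nabla0 (lshift n l) (nabla1 (rshift n k) uC) q = nabla01_lr (D l k).
Proof.
rewrite nabla1_rshift nabla0_lshift; apply: Complex_congr; apply: add_congr;
  [exact: erefl|congr (- _)| |exact: erefl]; exact: partial2N.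
Qed.

Lemma nabla01_rlE l k :
  nabla0 (rshift n l) (nabla1 (lshift n k) uC) q = nabla01_rl (D l k).
Proof.
rewrite nabla1_lshift nabla0_rshift; apply: Complex_congr; apply: add_congr;
  [| | |congr (- _)]; exact: partial2N.
Qed.

Lemma nabla01_rrE l k :
  nabla0 (rshift n l) (nabla1 (rshift n k) uC) q = nabla01_rr (D l k).
Proof.
rewrite nabla1_rshift nabla0_rshift; apply: Complex_congr; apply: add_congr;
  [exact: erefl| | |exact: erefl]; exact: partial2N.
Qed.

Lemma baston_coef_skew_rep A B :
  baston_coef A B u q = 2^-1 * skew_rep (qhessian u q) A B.
Proof.
rewrite /baston_coef; congr (_ * _).
(* The subtracted term has l and k exchanged; symmetry of second derivatives expresses it by the
   transpose of the same D. *)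
have sym l k : D k l = (fun b c => D l k c b).
  by apply: boolp.funext => b; apply: boolp.funext => c; exact: partial_comm.
case: (split_ordP A) => l ->; case: (split_ordP B) => k ->.
- rewrite skew_repEul !nabla01_llE (qhessianE q l k u2).
  apply: etrans (congr1 (fun d => _ - nabla01_ll d) (sym l k)) _.
  exact: (nabla01_ll_skew (D l k)).
- rewrite skew_repEur nabla01_lrE nabla01_rlE (qhessianE q l k u2).
  apply: etrans (congr1 (fun d => _ - nabla01_rl d) (sym l k)) _.
  exact: (nabla01_lr_skew (D l k)).
- rewrite skew_repEdl nabla01_rlE nabla01_lrE (qhessianE q l k u2).
  apply: etrans (congr1 (fun d => _ - nabla01_lr d) (sym l k)) _.
  exact: (nabla01_rl_skew (D l k)).
- rewrite skew_repEdr !nabla01_rrE (qhessianE q l k u2).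
  apply: etrans (congr1 (fun d => _ - nabla01_rr d) (sym l k)) _.
  exact: (nabla01_rr_skew (D l k)).
Qed.

End NablaNablaTheory.

End HessianBaston.

(** * Polynomials that vanish at all natural points *)

Section PolynomialValues.
Variable K : numDomainType.

Lemma poly_eq0_on_nat (p : {poly K}) : (forall t : nat, p.[t%:R] = 0) -> p = 0.
Proof.
move=> p0; apply/eqP; apply: contraT => pn0.
have := @max_poly_roots _ p [seq t%:R | t <- iota 0 (size p)] pn0.
rewrite size_map size_iota ltnn => -> //.
  by apply/allP => _ /mapP[t _ ->]; apply/rootP.
by rewrite map_inj_uniq ?iota_uniq // => s t /eqP; rewrite eqr_nat => /eqP.
Qed.

(** Reduction modulo d isolates the lowest digit, and division by d shifts the others down for the
    induction. *)
Lemma base_digits_inj d n (a b : 'I_n -> nat) :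
  (forall i, a i < d)%N -> (forall i, b i < d)%N ->
  (\sum_i a i * d ^ i = \sum_i b i * d ^ i)%N -> a =1 b.
Proof.
elim: n a b => [|n IHn] a b ad bd; first by move=> _ [].
rewrite !big_ord_recl !expn0 !muln1.
have shift (c : 'I_n.+1 -> nat) : (\sum_(i < n) c (lift ord0 i) * d ^ lift ord0 i =
    (\sum_(i < n) c (lift ord0 i) * d ^ i) * d)%N.
  by rewrite big_distrl; apply: eq_bigr => i _; rewrite lift0 expnSr mulnA.
rewrite !shift => E.
have d0 : (0 < d)%N by apply: leq_ltn_trans (ad ord0).
have E0 : a ord0 = b ord0.
  have := congr1 (modn^~ d) E; rewrite /= ![(_ ord0 + _)%N]addnC !modnMDl.
  by rewrite !modn_small.
have E1 := congr1 (divn^~ d) E.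
rewrite /= ![(_ ord0 + _)%N]addnC !divnMDl // !divn_small // !addn0 in E1.
have eq_ab := IHn _ _ (fun i => ad _) (fun i => bd _) E1.
by move=> i; case: (unliftP ord0 i) => [j|] ->.
Qed.

Variable n : nat.
Implicit Types p : {mpoly K[n]}.

(* Kronecker substitution: the variable i is sent to t ^ (d ^ i). *)
Lemma mpoly_eq0_on_nat p :
  (forall lambda : 'I_n -> nat, p.@[fun i => (lambda i)%:R] = 0) -> p = 0.
Proof.
move=> p0; pose d := msize p.
pose e (m : 'X_{1..n}) := (\sum_i m i * d ^ i)%N.
(* All exponents in the support are below [msize p], so they are the digits of [e m] in base d. *)
have e_inj : {in msupp p &, injective e}.
  have small m : m \in msupp p -> forall i, (m i < d)%N.
    move=> /msize_mdeg_lt mp i; apply: leq_ltn_trans mp.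
    by rewrite mdegE (bigD1 i) //= leq_addr.
  by move=> m m' /small mp /small m'p /base_digits_inj E; apply/mnmP/E.
pose q : {poly K} := \sum_(m <- msupp p) p@_m *: 'X^(e m).
have q0 : q = 0.
  apply: poly_eq0_on_nat => t; rewrite -(p0 (fun i => t ^ (d ^ i))%N) mevalE.
  rewrite horner_sum; apply: eq_bigr => m _; rewrite hornerZ hornerXn.
  congr (_ * _); rewrite /e expr_sum; apply: eq_bigr => i _.
  by rewrite mulnC exprM natrX.
apply/mpolyP => m; rewrite mcoeff0; apply/eqP; rewrite mcoeff_eq0.
apply/negP => mp; have := mp; rewrite mcoeff_msupp => /eqP; apply.
rewrite -[RHS](coef0 K (e m)) -q0 coef_sum (bigD1_seq m) ?msupp_uniq //=.
rewrite coefZ coefXn eqxx mulr1 big_seq_cond big1 ?addr0 // => m' /andP[m'p ne].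
rewrite coefZ coefXn; case: eqP => [/e_inj E|_]; rewrite ?mulr0 //.
by rewrite E // eqxx in ne.
Qed.

End PolynomialValues.

(** * Expansions over words and their polynomials *)

Section Polarization.
Variable n : nat.
Implicit Type f : {ffun 'I_n -> 'I_n}.

Definition word_mnm f : 'X_{1..n} := (\sum_i U_(f i))%MM.

(** The exponents count the occurrences of each letter, and n letters fill n places without
    repetition exactly when each occurs once. *)
Lemma word_mnm_eq1 f : (word_mnm f == [multinom 1%N | i < n]) = injectiveb f.
Proof.
apply/eqP/injectiveP => [E i j fij|fI].
  apply/eqP; apply: contraT => ij.
  move/mnmP/(_ (f i)): E; rewrite mnmE mnm_sumE (bigD1 i) //= (bigD1 j) ?(eq_sym j) //=.
  by rewrite !mnm1E fij eqxx.
apply/mnmP => j; rewrite mnmE mnm_sumE (bigD1 (invF fI j)) //= mnm1E f_invF eqxx.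
rewrite big1 // => i ne; rewrite mnm1E; apply/eqP; rewrite eqb0.
by apply: contra ne => /eqP <-; rewrite invF_f.
Qed.

Definition word_poly (K : comNzRingType) (c : {ffun 'I_n -> 'I_n} -> K) :
    {mpoly K[n]} :=
  \sum_f c f *: 'X_[word_mnm f].

Lemma word_poly_eval (K : comNzRingType) c (lambda : 'I_n -> K) :
  (word_poly c).@[lambda] = \sum_f c f * \prod_i lambda (f i).
Proof.
rewrite /word_poly raddf_sum; apply: eq_bigr => f _ /=; rewrite mevalZ.
congr (_ * _); rewrite (_ : 'X_[_] = \prod_i 'X_(f i)).
  by rewrite rmorph_prod; apply: eq_bigr => i _; exact: mevalXU.
by apply: (big_morph _ (@mpolyXD _ _)); exact: mpolyX0.
Qed.

Lemma word_poly_coef1 (K : comNzRingType) c :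
  (word_poly (K := K) c)@_[multinom 1%N | i < n] =
  \sum_(f : {ffun 'I_n -> 'I_n} | injectiveb f) c f.
Proof.
rewrite /word_poly raddf_sum [RHS]big_mkcond; apply: eq_bigr => f _ /=.
by rewrite mcoeffZ mcoeffX word_mnm_eq1; case: (injectiveb f); rewrite ?mulr1 ?mulr0.
Qed.

Lemma meval_map_mpoly (K L : comNzRingType) (g : {rmorphism K -> L}) (p : {mpoly K[n]})
    (lambda : 'I_n -> K) :
  (map_mpoly g p).@[g \o lambda] = g p.@[lambda].
Proof.
rewrite [in LHS](mpolyE p) [in RHS]mevalE.
rewrite (rmorph_sum g) (raddf_sum (map_mpoly g)) (raddf_sum (meval _)).
apply: eq_bigr => m _; rewrite /= map_mpolyZ map_mpolyX.
rewrite mevalZ mevalX rmorphM rmorph_prod.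
by congr (_ * _); apply: eq_bigr => i _; rewrite rmorphXn.
Qed.

End Polarization.

(** * Moore determinants as n-th powers of two-forms *)

Section MooreForm.
Variables (R : realType) (n : nat) (A : algType R[i]) (w : 'I_(n + n) -> A).
Hypothesis wA : anticommuting w.
Implicit Types (M : 'M[quaternion R]_n) (H : 'I_n -> 'M[quaternion R]_n).

Lemma pow2_fact_neq0 : 2 ^+ n * n`!%:R != 0 :> R[i].
Proof. by rewrite mulf_neq0 ?expf_neq0 ?pnatr_eq0 // -lt0n fact_gt0. Qed.

(* The case nu = 1 of the expansion of form2 shows that the frame w' obtained from
   a unitary E has the same volume as w: no determinant of E is needed. *)
Lemma volume_unitary (E : 'M[quaternion R]_n) : E *m qadj E = 1%:M ->
  volume (frame_change w (complex_rep E)) = volume w.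
Proof.
move=> EE; pose one : 'rV[R]_n := const_mx 1.
have one_diag : diag_mx (map_mx (@qreal R) one) = 1%:M.
  by apply/matrixP => i j; rewrite !mxE.
have := exp_form2_symplectic (map_mx (real_complex R) one)
  (anticommuting_frame_change (complex_rep E) wA).
rewrite -form2_frame_change -skew_rep_diag -skew_rep_conj one_diag mulmx1 EE.
rewrite -one_diag skew_rep_diag exp_form2_symplectic //.
rewrite big1 => [|l _]; last by rewrite !mxE.
by rewrite mulr1 => /(scalerI pow2_fact_neq0).
Qed.

Lemma form2_moore M : qadj M = M ->
  form2 w (skew_rep M) ^+ n = (2 ^+ n * n`!%:R * (moore_det M)%:C%C) *: volume w.
Proof.
move=> Mh; have [E0 [nu0 [E0E EE0 D0]]] := quaternionic_spectral Mh.
(* The spectral theorem makes the defining set nonempty, so [moore_det M] comes from an actual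
   diagonalization and is not the default 0. *)
have [E [nu [[EE1 EE2] D ->]]] : [set d : R | exists E (nu : 'rV[R]_n),
    [/\ qunitary E, qadjoint E *m M *m E = diag_mx (map_mx (@qreal R) nu)
      & d = \prod_l nu 0 l]]%classic (moore_det M).
  by apply: xgetPex; exists (\prod_l nu0 0 l), E0, nu0.
rewrite -[qadjoint E]/(qadj E) in EE1 EE2 D.
have -> : M = E *m diag_mx (map_mx (@qreal R) nu) *m qadj E.
  by rewrite -D !mulmxA EE2 mul1mx -mulmxA EE2 mulmx1.
rewrite skew_rep_conj form2_frame_change skew_rep_diag exp_form2_symplectic; last first.
  exact: anticommuting_frame_change.
rewrite volume_unitary // rmorph_prod; congr (_ * _ *: _).
by apply: eq_bigr => l _; rewrite mxE.
Qed.

Lemma skew_rep_comb H (lambda : 'I_n -> R) :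
  skew_rep (\sum_i qreal (lambda i) *: H i) =
  \sum_i (lambda i)%:C%C *: skew_rep (H i).
Proof.
rewrite (big_morph (@skew_rep R n n) (@skew_repD R n n) (id1 := 0)).
  by apply: eq_bigr => i _; rewrite skew_repZ.
rewrite -[X in skew_rep X](scale0r 0) -[X in X *: _](raddf0 (@qreal R)).
by rewrite skew_repZ scale0r.
Qed.

Lemma qadj_comb H (lambda : 'I_n -> R) : (forall i, qadj (H i) = H i) ->
  qadj (\sum_i qreal (lambda i) *: H i) = \sum_i qreal (lambda i) *: H i.
Proof.
move=> Hh; rewrite /qadj !raddf_sum; apply: eq_bigr => i _.
by rewrite -[LHS]/(qadj _) qadj_real Hh.
Qed.

Definition word_prod H (f : {ffun 'I_n -> 'I_n}) : A :=
  \prod_i form2 w (skew_rep (H (f i))).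

(** Expanding the n-th power over words turns [form2_moore] into an identity whose left-hand side is
    visibly polynomial in [lambda]. *)
Lemma word_prod_moore H (lambda : 'I_n -> R) : (forall i, qadj (H i) = H i) ->
  \sum_(f : {ffun 'I_n -> 'I_n}) (\prod_i lambda (f i))%:C%C *: word_prod H f =
  (2 ^+ n * n`!%:R * (moore_det (\sum_i qreal (lambda i) *: H i))%:C%C) *: volume w.
Proof.
move=> Hh; rewrite -form2_moore ?qadj_comb // skew_rep_comb form2_sum exp_sum_ffun.
apply: eq_bigr => f _; rewrite /word_prod rmorph_prod -scaler_prod.
by apply: eq_bigr => i _; rewrite form2Z.
Qed.

Lemma word_prod_injective H (f : {ffun 'I_n -> 'I_n}) : injectiveb f ->
  word_prod H f = \prod_i form2 w (skew_rep (H i)).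
Proof.
move=> fI; apply: (prod_comm_reindex (b := fun i => form2 w (skew_rep (H i)))) fI.
by move=> i j; apply: form2_comm.
Qed.

End MooreForm.

(** * Polarization and existence of the determinant polynomial *)

Section MixedDiscriminant.
Variables (R : realType) (n : nat).
Implicit Types (H : 'I_n -> 'M[quaternion R]_n).

Lemma form2_polarization m (w : 'I_(n + n) -> exterior_alg R[i] m) H
    (p : {mpoly R[n]}) :
  anticommuting w -> (forall i, qadj (H i) = H i) ->
  (forall lambda : 'I_n -> R,
     p.@[lambda] = moore_det (\sum_i qreal (lambda i) *: H i)) ->
  \prod_i form2 w (skew_rep (H i)) =
  (2 ^+ n * (p@_[multinom 1%N | i < n])%:C%C) *: volume w.
Proof.
move=> wA Hh pE; apply/ffunP => S.
(* P is the difference of the two sides of [word_prod_moore] in the coordinate S. It vanishes at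
   natural points, which are real, hence identically. *)
pose P : {mpoly R[i][n]} := word_poly (K := R[i])
    (fun f => (word_prod w H f : exterior R[i] m) S)
  - ((2 ^+ n * n`!%:R) * (volume w : exterior R[i] m) S)
      *: map_mpoly (real_complex R) p.
have P0 : P = 0.
  apply: mpoly_eq0_on_nat => lambda.
  have -> : P.@[fun i => (lambda i)%:R] =
      P.@[real_complex R \o (fun i => (lambda i)%:R)].
    by apply: meval_eq => i /=; rewrite rmorph_nat.
  rewrite raddfB /= mevalZ meval_map_mpoly pE word_poly_eval; apply/eqP.
  rewrite subr_eq0; apply/eqP.
  have /ffunP/(_ S) := word_prod_moore wA (fun i => (lambda i)%:R) Hh.
  rewrite ffunE /= [in X in _ = X -> _]/GRing.scale /= mulrAC => <-.
  rewrite sum_ffunE; apply: eq_bigr => f _; rewrite ffunE mulrC rmorph_prod.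
  by [].
have := congr1 (mcoeff [multinom 1%N | i < n]) P0.
rewrite mcoeff0 raddfB /= mcoeffZ mcoeff_map_mpoly word_poly_coef1.
rewrite (eq_bigr
  (fun=> (\prod_i form2 w (skew_rep (H i)) : exterior R[i] m) S)); last first.
  by move=> f fI; rewrite (word_prod_injective wA H fI).
rewrite sumr_const card_injectiveb => /eqP; rewrite subr_eq0 => /eqP E.
have nf0 : n`!%:R != 0 :> R[i] by rewrite pnatr_eq0 -lt0n fact_gt0.
apply: (mulfI nf0); rewrite mulr_natl E ffunE /GRing.scale /=; ring.
Qed.

(** In the canonical frame the top coordinate of [word_prod_moore] is the determinant times a
    nonzero constant v; dividing by v gives the polynomial. *)
Lemma exists_moore_poly H : (forall i, qadj (H i) = H i) ->
  exists p : {mpoly R[n]}, forall lambda : 'I_n -> R,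
    p.@[lambda] = moore_det (\sum_i qreal (lambda i) *: H i).
Proof.
move=> Hh; pose w (i : 'I_(n + n)) := exterior_basis R[i] [set i].
have wA : anticommuting w by move=> i j; apply: exterior_basis1_anticomm.
pose v : R[i] := 2 ^+ n * n`!%:R * (volume w : exterior R[i] (n + n)) setT.
have v0 : v != 0.
  rewrite mulf_neq0 ?pow2_fact_neq0 //.
  have [e ->] := volume_exterior_basis R[i] n.
  by rewrite !ffunE eqxx /GRing.scale /= mulr1 signr_eq0.
(* The coefficients are a priori complex; since [lambda] and the determinant are real, taking real
   parts preserves the identity. *)
exists (word_poly (fun f => complex.Re ((word_prod w H f : exterior R[i] _) setT / v))).
move=> lambda; rewrite word_poly_eval.
have /ffunP/(_ setT) := word_prod_moore wA lambda Hh.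
rewrite ffunE /= [in X in _ = X -> _]/GRing.scale /= mulrAC -/v.
rewrite sum_ffunE => /(congr1 (fun z => complex.Re (z / v))).
rewrite (mulrC v) mulfK // => E; apply: etrans _ E.
rewrite mulr_suml raddf_sum; apply: eq_bigr => f _.
rewrite ffunE [in RHS]/GRing.scale /= -mulrA.
by case: (_ / v) => a b /=; rewrite mul0r subr0 mulrC.
Qed.

End MixedDiscriminant.

Theorem theorem1p3 (R : realType) (n : nat) (hn : (0 < n)%N)
    (omega : (n + n).-tuple 'rV[R[i]]_(n + n))
    (homega : basis_of {: 'rV[R[i]]_(n + n)} omega)
    (u : 'I_n -> Hn R n -> R) (hu : forall i, Ck 2 (u i)) (q : Hn R n) :
  \big[@wedge _ _ / exterior1 _ _]_(i < n) baston omega (u i) q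
  = (n`!%:R * mixed_MA u q)%:C%C *: Omega omega.
Proof.
pose w (i : 'I_(n + n)) : exterior_alg R[i] (n + n) := basis_form omega i.
have wA : anticommuting w by move=> i j; apply: exterior_vec_anticomm.
pose H i := qhessian (u i) q.
have Hh i : qadj (H i) = H i by apply: qhessian_hyperhermitian.
(* As a determinant polynomial exists, [mixed_MA u q] is read off such a polynomial and is not the
   default 0. *)
have [p [pE mixedE]] : [set c : R | exists p : {mpoly R[n]},
    (forall lambda : 'I_n -> R,
       p.@[lambda] = moore_det (\sum_i qreal (lambda i) *: H i)) /\
    c = p@_[multinom 1%N | i < n] / n`!%:R]%classic (mixed_MA u q).
  have [p pE] := exists_moore_poly Hh.
  by apply: xgetPex; exists (p@_[multinom 1%N | i < n] / n`!%:R), p.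
have bastonE i : baston omega (u i) q = 2^-1 *: form2 w (skew_rep (H i)).
  rewrite -form2Z; apply: eq_bigr => a _; apply: eq_bigr => b _.
  by rewrite mxE baston_coef_skew_rep.
transitivity (\prod_(i < n) (2^-1 *: form2 w (skew_rep (H i)))).
  by apply: eq_bigr => i _; apply: bastonE.
rewrite scaler_prod prodr_const card_ord (form2_polarization wA Hh pE) scalerA mulrA.
rewrite -exprMn mulVf ?pnatr_eq0 // expr1n mul1r mixedE.
have nf0 : n`!%:R != 0 :> R by rewrite pnatr_eq0 -lt0n fact_gt0.
by rewrite mulrC divfK.
Qed.
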